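(* Let $R$ be a complete local ring with perfect residue field of characteristic $p>0$ in which $p$ is not a zero divisor, and let $G$ be a formal group of finite height over $R$. The natural map $$\mathcal O(\underline{\hom}(\mathbb Z/p,G))\longrightarrow R\times\mathcal O(\underline{\mathrm{level}}(\mathbb Z/p,G))$$ is injective.
   Context: A complete local ring is a local ring complete and separated in its adic topology; a formal group over $R$ means a formal group over $S=\mathrm{spf}\,R$, i.e. a commutative group object in formal schemes over $S$, locally isomorphic to $S\times\widehat{\mathbb A}^1$ as a pointed formal scheme. For a finite abelian group $A$, $\underline{\hom}(A,G)$ is the affine formal scheme over $S$ representing the functor $T\mapsto\{(u,\ell): u:T\to S,\ \ell\in\hom(A,u^*G(T))\}$. A divisor is a closed subscheme with invertible ideal sheaf which is finite, free and of finite presentation over the base; $[w]$ is the divisor of a section $w$. $\underline{\mathrm{level}}(A,G)$ is the closed formal subscheme of $\underline{\hom}(A,G)$ classifying level structures: those $\ell:A_T\to u^*G$ such that for each prime $q$ dividing $|A|$, $u^*G[q]=\ker(q)$ is a divisor on $u^*G$ and $\sum_{a\in A,\,qa=0}[\ell(a)]\le u^*G[q]$. $\mathcal O(-)$ denotes the ring of functions. The first component of the map, $\mathcal O(\underline{\hom}(A,G))\to R$, classifies the zero homomorphism; the second is restriction to $\underline{\mathrm{level}}(A,G)$. *)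

(* Defs.v *)
From HB Require Import structures.
From mathcomp Require Import all_boot all_order all_algebra.
From mathcomp Require Import boolp classical_sets.

Set Implicit Arguments.
Unset Strict Implicit.
Unset Printing Implicit Defensive.
Import GRing.Theory.
Local Open Scope ring_scope.
Local Open Scope classical_set_scope.

(* Formal schemes are treated through their functors of points, on ordinary   *)
(* (discrete) rings: spf R sends T to the ring maps R -> T that kill a power  *)
(* of the maximal ideal, and O(X) is the ring of natural maps X -> A^1.       *)
(* Operations on O(X) are written out pointwise: O(X) quantifies over all     *)
(* rings, so it is too large to be an instance of MathComp's ring structures. *)

Section LocalRings.
Variable R : comUnitRingType.

Definition local_ring := forall a b : R,
  a + b \is a GRing.unit -> a \is a GRing.unit \/ b \is a GRing.unit.

Definition maxideal : set R := [set a | a \isn't a GRing.unit].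

(* The coefficients [c i] make the case [n = 0] the unit ideal. *)
Definition maxpow (n : nat) : set R := [set a |
  exists (k : nat) (c : 'I_k -> R) (b : 'I_k -> 'I_n -> R),
    (forall i j, maxideal (b i j)) /\ a = \sum_(i < k) c i * \prod_(j < n) b i j].

Definition adic_separated := forall a : R, (forall n, maxpow n a) -> a = 0.

Definition adic_complete := forall s : nat -> R,
  (forall n, maxpow n (s n.+1 - s n)) -> exists l, forall n, maxpow n (l - s n).

Definition complete_local_ring :=
  [/\ local_ring, adic_separated & adic_complete].

Definition residue_field (k : fieldType) (res : {rmorphism R -> k}) :=
  (forall y, exists a, res a = y) /\ (forall a, res a = 0 <-> maxideal a).

End LocalRings.

Definition perfect_field (p : nat) (k : fieldType) :=
  p \in [pchar k] /\ forall y : k, exists z : k, z ^+ p = y.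

Section FormalSchemes.
Variable R : comUnitRingType.

(* An affine scheme over S: a map Spec T -> S. *)
Record tring := TRing {
  tcarrier :> comPzRingType;
  tstr : {rmorphism R -> tcarrier};
  tstr_cont : exists n, forall a, maxpow n a -> tstr a = 0
}.

Record thom (T T' : tring) := THom {
  tmor :> {rmorphism T -> T'};
  tmor_str : forall a, tmor (tstr T a) = tstr T' a
}.

Lemma thom_eq T T' (u v : thom T T') : (forall t, u t = v t) -> u = v.
Proof.
case: u v => [u hu] [v hv] /= uv.
have e : u = v.
  case: u v uv {hu hv} => [u cu] [v cv] /= uv.
  have e : u = v by apply/funext.
  case: _ / e cv {uv} => cv; congr GRing.RMorphism.Pack.
  move: cv; case: cu => [[a1] [b1]]; case=> [[a2] [b2]].
  by rewrite (Prop_irrelevance a1 a2) (Prop_irrelevance b1 b2).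
by case: _ / e hv => hv; rewrite (Prop_irrelevance hu hv).
Qed.

Definition thom_id (T : tring) : thom T T :=
  @THom T T (idfun : {rmorphism T -> T}) (fun=> erefl).

Lemma thom_comp_subproof T T' T'' (v : thom T' T'') (u : thom T T') a :
  (v \o u : {rmorphism T -> T''}) (tstr T a) = tstr T'' a.
Proof. by rewrite /= !tmor_str. Qed.

Definition thom_comp T T' T'' (v : thom T' T'') (u : thom T T') : thom T T'' :=
  THom (thom_comp_subproof v u).

Record functor := Functor {
  pts :> tring -> Type;
  fmap : forall T T', thom T T' -> pts T -> pts T';
  fmap_id : forall T x, fmap (thom_id T) x = x;
  fmap_comp : forall T T' T'' (v : thom T' T'') (u : thom T T') x,
    fmap (thom_comp v u) x = fmap v (fmap u x)
}.

Definition subobj (X : functor) := forall T, set (X T).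

Definition whole (X : functor) : subobj X := fun T => setT.
Arguments whole X : clear implicits.

(* The ring of functions of [Z]. For a [Z] stable under [fmap], as are all    *)
(* the subobjects below, this is naturality of Z -> A^1.                      *)
Record ofun (X : functor) (Z : subobj X) := OFun {
  oev :> forall T (x : X T), Z T x -> T;
  oev_nat : forall T T' (u : thom T T') (x : X T) (zx : Z T x)
    (zux : Z T' (fmap u x)), oev zux = u (oev zx)
}.

Arguments oev [X Z] o T x zx.

Definition restrict (X : functor) (Z : subobj X) (f : ofun (whole X)) : ofun Z :=
  @OFun X Z (fun T x _ => f T x I)
    (fun T T' u x _ _ => @oev_nat X (whole X) f T T' u x I I).

Section Subschemes.
Variables (X : functor) (U : subobj X).
Arguments U T _ : clear implicits.

Definition vanishing_ideal (D : subobj X) (f : ofun U) : Prop :=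
  forall T x (ux : U T x), D T x -> f T x ux = 0.

Definition zero_locus (J : ofun U -> Prop) : subobj X :=
  fun T => [set x | exists ux : U T x, forall f, J f -> f T x ux = 0].

Definition principal_ideal (f h : ofun U) : Prop :=
  exists c : ofun U, forall T x (ux : U T x),
    h T x ux = c T x ux * f T x ux.

Definition nonzerodivisor (f : ofun U) := forall h : ofun U,
  (forall T x (ux : U T x), h T x ux * f T x ux = 0) ->
  forall T x (ux : U T x), h T x ux = 0.

Definition ideal_prod (I : finType) (P : pred I) (J : I -> ofun U -> Prop)
    (f : ofun U) : Prop :=
  exists (k : nat) (c : 'I_k -> ofun U) (g : 'I_k -> I -> ofun U),
    (forall i a, P a -> J a (g i a)) /\
    (forall T x (ux : U T x), f T x ux =
      \sum_(i < k) c i T x ux * \prod_(a | P a) g i a T x ux).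

End Subschemes.

Definition subscheme (X : functor) (D D' : subobj X) :=
  forall T x, D T x -> D' T x.

Definition closed_subscheme (X : functor) (D : subobj X) :=
  forall T x, D T x <-> zero_locus (vanishing_ideal (U := whole X) D) x.

(* Sums of divisors multiply the ideals. *)
Definition divisor_sum (X : functor) (I : finType) (P : pred I)
    (D : I -> subobj X) : subobj X :=
  zero_locus (ideal_prod P (fun a => vanishing_ideal (U := whole X) (D a))).

Record abfunctor := AbFunctor {
  apts :> tring -> zmodType;
  amap : forall T T', thom T T' -> {additive apts T -> apts T'};
  amap_id : forall T x, amap (thom_id T) x = x;
  amap_comp : forall T T' T'' (v : thom T' T'') (u : thom T T') x,
    amap (thom_comp v u) x = amap v (amap u x)
}.

Arguments amap [a T T'] u.

(* A pointed isomorphism from [G] to S x \hat A^1, whose points over T are    *)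
(* the nilpotent elements of T.                                               *)
Record coordinate (G : abfunctor) (x : forall T, G T -> T) : Prop := {
  coord_nat : forall T T' (u : thom T T') g, x T' (amap u g) = u (x T g);
  coord_inj : forall T, injective (x T);
  coord_im : forall (T : tring) (t : T), (exists g, x T g = t) <-> (exists n, t ^+ n = 0);
  coord0 : forall T, x T 0 = 0
}.

(* For R local, spf R has only one point, so that G is locally isomorphic to  *)
(* S x \hat A^1 iff it has a coordinate over all of S.                        *)
Record formal_group := FormalGroup {
  fgroup :> abfunctor;
  fgroup_coord : exists x : forall T, fgroup T -> T, coordinate x
}.

Section FormalGroup.
Variable G : formal_group.

(* On the special fibre, [p](x) is a power series in x^(p^h); the T killed by *)
(* the maximal ideal are the algebras over the residue field, and the [c i]   *)
(* lift the coefficients. The sum is finite since coordinates are nilpotent.  *)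
Definition frobenius_divides (p : nat) (x : forall T, G T -> T) (h : nat) :=
  exists c : nat -> R, forall T : tring,
    (forall a, maxideal a -> tstr T a = 0) ->
    forall (g : G T) n, x T g ^+ n = 0 ->
      x T (g *+ p) = \sum_(i < n) tstr T (c i) * x T g ^+ (i * p ^ h).

(* The height is the largest such h; it does not depend on the coordinate.    *)
Definition has_height (p h : nat) := exists x : forall T, G T -> T,
  [/\ coordinate x, frobenius_divides p x h & ~ frobenius_divides p x h.+1].

Definition finite_height (p : nat) := exists h, has_height p h.

Section BaseChange.
Variable T : tring.

(* u^* G = Spec T x_S G as a formal scheme, where u : Spec T -> S. *)
Definition bc_map T' T'' (v : thom T' T'') (x : thom T T' * G T') :
  thom T T'' * G T'' := (thom_comp v x.1, amap v x.2).

Lemma bc_map_id T' (x : thom T T' * G T') : bc_map (thom_id T') x = x.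
Proof.
by case: x => u g; rewrite /bc_map amap_id; congr pair; apply: thom_eq.
Qed.

Lemma bc_map_comp T1 T2 T3 (v : thom T2 T3) (u : thom T1 T2) x :
  bc_map (thom_comp v u) x = bc_map v (bc_map u x).
Proof.
by case: x => w g; rewrite /bc_map amap_comp; congr pair; apply: thom_eq.
Qed.

Definition base_change : functor := Functor bc_map_id bc_map_comp.

(* The part of u^* G over the basic open set D(t) of Spec T. *)
Definition basic_open (t : T) : subobj base_change :=
  fun T' => [set x : thom T T' * G T' | exists y : T', x.1 t * y = 1].

Definition invertible_ideal (D : subobj base_change) :=
  exists (n : nat) (t c : 'I_n -> T), \sum_(i < n) c i * t i = 1 /\
    forall i, exists f : ofun (basic_open (t i)),
      nonzerodivisor f /\
      forall h, vanishing_ideal D h <-> principal_ideal f h.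

(* [D] is isomorphic over Spec T to Spec B, where B is a T-algebra that is    *)
(* free of finite rank as a module. Such a B is of finite presentation.       *)
Definition finite_free (D : subobj base_change) :=
  exists (B : tring) (b : base_change B), D B b /\
    (forall T' (x : base_change T'), D T' x ->
       exists! v : thom B T', fmap v b = x) /\
    (exists (n : nat) (e : 'I_n -> B), forall y : B,
       exists! c : {ffun 'I_n -> T}, y = \sum_(i < n) b.1 (c i) * e i).

Definition divisor (D : subobj base_change) :=
  [/\ closed_subscheme D, invertible_ideal D & finite_free D].

Definition torsion (q : nat) : subobj base_change :=
  fun T' => [set x : thom T T' * G T' | x.2 *+ q = 0].

Definition section_divisor (w : G T) : subobj base_change :=
  fun T' => [set x : thom T T' * G T' | x.2 = amap x.1 w].

End BaseChange.

Section Level.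
Variable A : finZmodType.

Definition hom_map T T' (u : thom T T') (l : {additive A -> G T}) :
  {additive A -> G T'} := amap u \o l.

Lemma additive_eq (V : zmodType) (l m : {additive A -> V}) : l =1 m -> l = m.
Proof.
case: l m => [l cl] [m cm] /= lm.
have e : l = m by apply/funext.
case: _ / e cm {lm} => cm; congr Algebra.Additive.Pack.
case: cl => [[a1]]; case: cm => [[a2]].
by rewrite (Prop_irrelevance a1 a2).
Qed.

Lemma hom_map_id T l : hom_map (thom_id T) l = l.
Proof. by apply: additive_eq => a; rewrite /= amap_id. Qed.

Lemma hom_map_comp T T' T'' (v : thom T' T'') (u : thom T T') l :
  hom_map (thom_comp v u) l = hom_map v (hom_map u l).
Proof. by apply: additive_eq => a; rewrite /= amap_comp. Qed.

Definition hom_scheme : functor := Functor hom_map_id hom_map_comp.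

Definition zero_hom T : hom_scheme T := (\0 : {additive A -> G T}).

Definition level : subobj hom_scheme := fun T => [set l : {additive A -> G T} |
  forall q, prime q -> (q %| #|A|)%N ->
    divisor (torsion (T := T) q) /\
    subscheme (divisor_sum (fun a => a *+ q == 0)
                 (fun a => section_divisor (l a)))
              (torsion (T := T) q)].

(* The component of the map in R = O(S): [f] pulled back along the section    *)
(* S -> hom(A, G) classifying the zero homomorphism. For R complete local,    *)
(* it is characterized by [zero_valueP] and [zero_value_unique].              *)
Definition zero_value (f : ofun (whole hom_scheme)) : R :=
  xget 0 [set r | forall T, f T (zero_hom T) I = tstr T r].

Definition natural_map (f : ofun (whole hom_scheme)) : R * ofun level :=
  (zero_value f, restrict level f).

End Level.
End FormalGroup.
End FormalSchemes.
Arguments whole [R] X T _.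
Arguments oev [R X Z] o T x zx.
Arguments amap [R a T T'] u.
Arguments level [R] G A T _.
Arguments natural_map [R] G A f.

Section ZeroValue.
Variable R : comUnitRingType.

Lemma maxpow_closed n a x y :
  maxpow n x -> maxpow n y -> maxpow (R := R) n (a * x + y).
Proof.
move=> [k1 [c1 [b1 [m1 ->]]]] [k2 [c2 [b2 [m2 ->]]]].
exists (k1 + k2)%N.
exists (fun i => match split i with inl j => a * c1 j | inr j => c2 j end).
exists (fun i => match split i with inl j => b1 j | inr j => b2 j end).
split; first by move=> i j; case: (split i).
rewrite big_split_ord /= mulr_sumr; congr (_ + _); apply: eq_bigr => i _.
  by rewrite (unsplitK (inl i)) mulrA.
by rewrite (unsplitK (inr i)).
Qed.

Lemma maxpow0 n : maxpow n (0 : R).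
Proof.
exists 0%N, (fun=> 0), (fun _ _ => 0); split; first by case.
by rewrite big_ord0.
Qed.

Lemma maxpow1 n : local_ring R -> ~ maxpow n.+1 (1 : R).
Proof.
move=> locR [k [c [b [mb e]]]]; suff: maxideal (1 : R) by rewrite /maxideal /= unitr1.
rewrite e; apply: big_ind => [|x y mx my|i _]; rewrite /maxideal /=.
- by rewrite unitr0.
- by apply/negP => /locR []; apply/negP.
- rewrite big_ord_recl !unitrM negb_and negb_and; apply/orP; right.
  by apply/orP; left; apply: mb.
Qed.

Definition maxpow_pred (locR : local_ring R) n : {pred R} :=
  fun a => `[< maxpow n.+1 a >].

Lemma maxpow_idealr locR n : idealr_closed (maxpow_pred locR n).
Proof.
split; first by apply/asboolP/maxpow0.
  by apply/asboolPn/maxpow1.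
by move=> a x y /asboolP mx /asboolP my; apply/asboolP/maxpow_closed.
Qed.

HB.instance Definition _ locR n :=
  isIdealr.Build R (maxpow_pred locR n) (maxpow_idealr locR n).

Local Notation quo locR n := {ideal_quot (maxpow_pred locR n)}.

Definition quo_pi locR n (a : R) : quo locR n := \pi_(quo locR n)%qT a.

Lemma quo_piP locR n a b :
  quo_pi locR n a = quo_pi locR n b <-> maxpow n.+1 (a - b).
Proof.
rewrite /quo_pi; split => [/eqP|mab].
  by rewrite piE Quotient.equivE => /asboolP.
by apply/eqP; rewrite piE Quotient.equivE; apply/asboolP.
Qed.

Lemma quo_pi_nmod locR n : nmod_morphism (@quo_pi locR n).
Proof. by split => [|x y]; rewrite /quo_pi piE. Qed.

Lemma quo_pi_monoid locR n : monoid_morphism (@quo_pi locR n).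
Proof. by split => [|x y]; rewrite /quo_pi piE. Qed.

HB.instance Definition _ locR n :=
  GRing.isNmodMorphism.Build R (quo locR n) (@quo_pi locR n) (quo_pi_nmod locR n).
HB.instance Definition _ locR n :=
  GRing.isMonoidMorphism.Build R (quo locR n) (@quo_pi locR n)
    (quo_pi_monoid locR n).

Lemma quo_cont locR n :
  exists m, forall a, maxpow m a -> @quo_pi locR n a = 0.
Proof.
exists n.+1 => a ma; rewrite -(rmorph0 (@quo_pi locR n)).
by apply/quo_piP; rewrite subr0.
Qed.

(* Spec (R / m^(n.+1)) *)
Definition quo_tring locR n : tring R := TRing (quo_cont locR n).

Lemma quo_thom locR n (T : tring R) :
  (forall a, maxpow n.+1 a -> tstr T a = 0) ->
  exists u : thom (quo_tring locR n) T, forall a, u (quo_pi locR n a) = tstr T a.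
Proof.
move=> kerT; pose f (x : quo locR n) := tstr T (repr x).
have fE a : f (quo_pi locR n a) = tstr T a.
  apply/eqP; rewrite -subr_eq0 -rmorphB; apply/eqP/kerT/(quo_piP locR).
  by rewrite /quo_pi reprK.
have surj (x : quo locR n) : exists a, x = quo_pi locR n a.
  by exists (repr x); rewrite /quo_pi reprK.
have fD : nmod_morphism f.
  split=> [|x y]; first by rewrite -(rmorph0 (@quo_pi locR n)) fE rmorph0.
  case: (surj x) (surj y) => [a ->] [b ->].
  by rewrite -rmorphD !fE rmorphD.
have fM : monoid_morphism f.
  split=> [|x y]; first by rewrite -(rmorph1 (@quo_pi locR n)) fE rmorph1.
  case: (surj x) (surj y) => [a ->] [b ->].
  by rewrite -rmorphM !fE rmorphM.
pose fa := GRing.isNmodMorphism.Build _ _ f fD.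
pose fm := GRing.isMonoidMorphism.Build _ _ f fM.
pose F : {rmorphism quo locR n -> T} := HB.pack f fa fm.
by exists (@THom R (quo_tring locR n) T F fE).
Qed.

Lemma maxpow_le (m n : nat) (a : R) : (m <= n)%N -> maxpow n a -> maxpow m a.
Proof.
move=> /subnKC <-; move: (n - m)%N => d [k [c [b [mb ->]]]].
exists k, (fun i => c i * \prod_(j < d) b i (rshift m j)),
  (fun i j => b i (lshift d j)); split=> //.
apply: eq_bigr => i _; rewrite big_split_ord /= -mulrA; congr (_ * _).
exact: mulrC.
Qed.

Lemma zero_value_unique (r r' : R) : complete_local_ring R ->
  (forall T : tring R, tstr T r = tstr T r') -> r = r'.
Proof.
move=> [locR sepR _] rr'; apply/eqP; rewrite -subr_eq0; apply/eqP/sepR => n.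
by apply: (@maxpow_le n n.+1) => //; apply/(quo_piP locR)/(rr' (quo_tring locR n)).
Qed.

Lemma zero_valueP (G : formal_group R) (A : finZmodType)
    (f : ofun (whole (hom_scheme G A))) : complete_local_ring R ->
  forall T, f T (zero_hom G A T) I = tstr T (zero_value f).
Proof.
move=> [locR _ cplR].
suff: exists r, forall T, f T (zero_hom G A T) I = tstr T r.
  by move=> ex; apply: (xgetPex 0 ex).
have zeroE T T' (u : thom T T') : fmap u (zero_hom G A T) = zero_hom G A T'.
  by apply: additive_eq => a /=; rewrite raddf0.
have natE T T' (u : thom T T') :
    f T' (zero_hom G A T') I = u (f T (zero_hom G A T) I).
  rewrite -(@oev_nat _ _ _ f T T' u (zero_hom G A T) I I).
  by rewrite -[in LHS](zeroE _ _ u).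
pose s n : R := repr (f (quo_tring locR n) (zero_hom G A _) I : quo locR n).
have sE n : f (quo_tring locR n) (zero_hom G A _) I = quo_pi locR n (s n).
  by rewrite /quo_pi reprK.
have sT n (T : tring R) : (forall a, maxpow n.+1 a -> tstr T a = 0) ->
    f T (zero_hom G A T) I = tstr T (s n).
  by move=> /(quo_thom locR)[u uE]; rewrite (natE _ _ u) sE uE.
have kerQ n m a : (n <= m)%N ->
    maxpow m.+1 a -> tstr (quo_tring locR n) a = 0.
  move=> nm ma; rewrite /= -(rmorph0 (@quo_pi locR n)); apply/quo_piP.
  by rewrite subr0; apply: maxpow_le ma.
have [|l ls] := cplR s.
  move=> n; apply: (@maxpow_le n n.+1) => //; apply/(quo_piP locR).
  rewrite -sE; symmetry; apply: (sT n.+1 (quo_tring locR n)) => a; exact: kerQ.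
exists l => T; have [n kerT] := tstr_cont T.
rewrite (sT n) => [|a ma]; last by apply: kerT; apply: maxpow_le ma.
by apply/esym/eqP; rewrite -subr_eq0 -rmorphB; apply/eqP/kerT/ls.
Qed.

End ZeroValue.

(* Main.v *)
Require Import Defs.
From HB Require Import structures.
From mathcomp Require Import all_boot all_order all_algebra.
From mathcomp Require Import ring.
From mathcomp Require Import boolp classical_sets.
Set Implicit Arguments.
Unset Strict Implicit.
Unset Printing Implicit Defensive.
Import GRing.Theory.
Local Open Scope ring_scope.

(* Let F = X V1 be the power series of [p] in a coordinate x of G, and let    *)
(* V1 = V b be the Weierstrass preparation of V1: V is a monic polynomial, b  *)
(* is invertible and V(0) b(0) = p. A function on hom(Z/p, G) = {X V = 0} is  *)
(* a unique R-combination of 1, X, ..., X^(d-1), V, where d is the degree of  *)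
(* V. If it vanishes on {V = 0}, it is c V with c in R; if it also vanishes   *)
(* at 0, then c V(0) = 0, so that c p = 0 and c = 0.                          *)
(* It remains to see that {V = 0} consists of level structures, i.e. that     *)
(* the product of the X - x([i] y), i < p, divides F when V(y) = 0. By Newton *)
(* interpolation this holds if the differences of the x([i] y) are not zero   *)
(* divisors in O({V = 0}). These differences are unit multiples of y, which   *)
(* divides p, and p is regular on O({V = 0}) since this is free over R.       *)

(** * Evaluation of polynomials and bases of monic polynomials *)

(** A homomorphism from Z/p amounts to a point of G killed by p, that is ([torsionP], with the
    factorization of [p] from [weierstrass_multiplication]) to a root of W = X V. Functions on such
    schemes are computed from the functor of points: for a monic D whose lower coefficients lie in
    the maximal ideal, a natural function on the roots of D is determined by its value at the
    universal root, so it has a unique expansion in any basis with one monic polynomial in each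
    degree ([expansion]). Over R itself, completeness turns compatible coefficients into elements of
    R ([expansion_global]). Taking D = X^k W for all k yields power series and Weierstrass division
    on the formal line, from which all statements about divisors follow.

    [hom_function_eq0] carries out the argument in the basis 1, ..., X^m, V of O({W = 0}), where V
    has degree m + 1. It needs that roots of V give level structures ([root_level]), which rests on
    [newton_division] for the inequality of divisors and on [torsion_divisor] for the p-torsion. *)

(** Test rings may be zero, while polynomial quotients are taken over nonzero rings. The equality is
    one of ring structures, so that [universal_rootP] can transport along it. *)
Lemma comNzRing_of_nontrivial (C : comPzRingType) :
  1 != 0 :> C -> exists N : comNzRingType, (N : comPzRingType) = C.
Proof.
move=> h.
pose m := GRing.PzSemiRing_isNonZero.Build C h.
pose N : comNzRingType := HB.pack (GRing.ComPzRing.sort C) m.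
exists N; rewrite /N /m.
by case: C h {m N} => s [a1 a2 a3 a4 a5 a6 a7 a8 a9 b1 b2] h.
Qed.

Lemma trivial_ring (C : pzRingType) (a b : C) : 1 = 0 :> C -> a = b.
Proof. by move=> e; rewrite -[a]mulr1 -[b]mulr1 e !mulr0. Qed.

Definition nilpotent_elt (C : pzRingType) (y : C) := exists n, y ^+ n = 0.

Lemma nilpotentX_ge (C : pzRingType) (y : C) m n :
  (m <= n)%N -> y ^+ m = 0 -> y ^+ n = 0.
Proof. by move=> /subnKC <- h; rewrite exprD h mul0r. Qed.

Lemma nilpotent0 (C : pzRingType) : nilpotent_elt (0 : C).
Proof. by exists 1%N; rewrite expr1. Qed.

Lemma nilpotentMl (C : comPzRingType) (a y : C) :
  nilpotent_elt y -> nilpotent_elt (a * y).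
Proof. by move=> [n yn]; exists n; rewrite exprMn yn mulr0. Qed.

Lemma nilpotentN (C : comPzRingType) (y : C) :
  nilpotent_elt y -> nilpotent_elt (- y).
Proof. by rewrite -mulN1r; apply: nilpotentMl. Qed.

Lemma nilpotentD (C : comPzRingType) (y z : C) :
  nilpotent_elt y -> nilpotent_elt z -> nilpotent_elt (y + z).
Proof.
move=> [m ym] [n zn]; exists (m + n)%N; rewrite exprDn big1 // => i _.
have [le_i|lt_i] := leqP n i.
  by rewrite (nilpotentX_ge le_i zn) mulr0 mul0rn.
rewrite (@nilpotentX_ge _ y m) ?mul0r ?mul0rn //.
by rewrite -addnBA ?leq_addr // ltnW.
Qed.

Lemma nilpotent_rmorph (C C' : pzRingType) (u : {rmorphism C -> C'}) (y : C) :
  nilpotent_elt y -> nilpotent_elt (u y).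
Proof. by move=> [n yn]; exists n; rewrite -rmorphXn yn rmorph0. Qed.

Lemma nilpotent_unit (C : comPzRingType) (y : C) :
  nilpotent_elt y -> exists v, v * (1 + y) = 1.
Proof.
move=> /nilpotentN[n yn]; exists (\sum_(i < n) (- y) ^+ i).
have := subrX1 (- y) n; rewrite yn sub0r -opprD mulNr => /oppr_inj e.
by rewrite mulrC addrC -e.
Qed.

Section Evaluation.
Variables (A : nzRingType) (C : comPzRingType) (u : {rmorphism A -> C}) (y : C).

(** An explicit sum, since [C] may be the zero ring and [q] then has no image in a polynomial ring
    over [C]. *)
Definition ev (q : {poly A}) : C := \sum_(i < size q) u q`_i * y ^+ i.

Lemma ev_widen (k : nat) (q : {poly A}) :
  (size q <= k)%N -> ev q = \sum_(i < k) u q`_i * y ^+ i.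
Proof.
move=> sk; rewrite /ev (big_ord_widen k (fun i => u q`_i * y ^+ i) sk).
rewrite big_mkcond; apply: eq_bigr => i _; case: ltnP => // ?.
by rewrite nth_default // rmorph0 mul0r.
Qed.

Lemma ev_zmod : zmod_morphism ev.
Proof.
move=> p q; pose k := maxn (size (p - q)) (maxn (size p) (size q)).
rewrite !(@ev_widen k) ?leq_max ?leqnn ?orbT // -sumrB; apply: eq_bigr => i _.
by rewrite coefB rmorphB mulrBl.
Qed.

HB.instance Definition _ := GRing.isZmodMorphism.Build _ _ ev ev_zmod.

Lemma evC a : ev a%:P = u a.
Proof.
by rewrite (@ev_widen 1) ?size_polyC_leq1 // big_ord1 coefC eqxx expr0 mulr1.
Qed.

Lemma evMX q : ev (q * 'X) = ev q * y.
Proof.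
rewrite (@ev_widen (size q).+1); last first.
  by rewrite (leq_trans (size_polyMleq _ _)) // size_polyX addn2.
rewrite big_ord_recl coefMX eqxx rmorph0 mul0r add0r /ev mulr_suml.
by apply: eq_bigr => i _; rewrite coefMX /= exprSr mulrA.
Qed.

Lemma ev_monoid : monoid_morphism ev.
Proof.
split=> [|p q]; first by rewrite -[1]/(1%:P) evC rmorph1.
elim/poly_ind: q => [|q a IH]; first by rewrite mulr0 raddf0 mulr0.
rewrite mulrDr !raddfD /= mulrA !evMX IH evC mulrDr mulrA; congr (_ + _).
rewrite (@ev_widen (size p) (p * _)); last first.
  rewrite (leq_trans (size_polyMleq _ _)) // size_polyC.
  by case: (_ != _); rewrite ?addn1 ?addn0 ?leq_pred.
rewrite {1}/ev mulr_suml; apply: eq_bigr => i _.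
by rewrite coefMC rmorphM mulrAC.
Qed.

HB.instance Definition _ := GRing.isMonoidMorphism.Build _ _ ev ev_monoid.

Lemma evX : ev 'X = y.
Proof. by rewrite -['X]mul1r evMX rmorph1 mul1r. Qed.

Lemma evXn k : ev 'X^k = y ^+ k.
Proof. by rewrite rmorphXn /= evX. Qed.

End Evaluation.

Lemma rmorph_ev (A : nzRingType) (C C' : comPzRingType)
    (u : {rmorphism A -> C}) (v : {rmorphism C -> C'}) (w : {rmorphism A -> C'})
    (y : C) (q : {poly A}) :
  (forall a, v (u a) = w a) -> v (ev u y q) = ev w (v y) q.
Proof.
move=> vu; rewrite /ev rmorph_sum; apply: eq_bigr => i _.
by rewrite rmorphM rmorphXn vu.
Qed.

Definition graded (A : nzRingType) (n : nat) (P : nat -> {poly A}) :=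
  forall i, (i < n)%N -> P i \is monic /\ size (P i) = i.+1.

(** The change of basis from the monomials is unitriangular: the top coefficient of [q] is forced to
    be the last [c i], and subtracting it lowers the degree. *)
Lemma graded_basis (A : nzRingType) n (P : nat -> {poly A}) (q : {poly A}) :
  graded n P -> (size q <= n)%N ->
  exists! c : {ffun 'I_n -> A}, q = \sum_(i < n) c i *: P i.
Proof.
elim: n q => [|n IH] q gP sq.
  exists [ffun=> 0]; split=> [|c _]; last by apply/ffunP; case.
  by rewrite big_ord0; apply/eqP; rewrite -size_poly_leq0.
have [mP sP] := gP n (ltnSn n).
have gP' : graded n P by move=> i lt_in; apply: gP; apply: leqW.
have sP' (c : 'I_n -> A) : (size (\sum_(i < n) c i *: P i)%R <= n)%N.
  apply: (leq_trans (size_sum _ _ _)); apply/bigmax_leqP => i _.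
  by rewrite (leq_trans (size_scale_leq _ _)) // (gP' i _).2.
have Pn : (P n)`_n = 1 by move: mP; rewrite monicE lead_coefE sP => /eqP.
have coef_n (c : 'I_n.+1 -> A) : (\sum_(i < n.+1) c i *: P i)`_n = c ord_max.
  rewrite big_ord_recr coefD coefZ Pn mulr1.
  by rewrite (nth_default _ (sP' (fun i => c (widen_ord _ i)))) add0r.
have sq' : (size (q - q`_n *: P n)%R <= n)%N.
  apply/leq_sizeP => j; rewrite leq_eqVlt coefB coefZ => /predU1P[<-|lt_nj].
    by rewrite Pn mulr1 subrr.
  rewrite (nth_default _ (leq_trans sq lt_nj)).
  by rewrite [(P n)`_j]nth_default ?sP // mulr0 subr0.
have [c [qE c_uniq]] := IH _ gP' sq'.
pose c' : {ffun 'I_n.+1 -> A} := [ffun i =>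
  if unlift ord_max i is Some j then c j else q`_n].
have liftE (i : 'I_n) : widen_ord (leqnSn n) i = lift ord_max i.
  by apply: val_inj; rewrite /= /bump leqNgt ltn_ord.
exists c'; split=> [|d dE].
  rewrite big_ord_recr /= /c' ffunE unlift_none; apply/eqP.
  rewrite -subr_eq qE; apply/eqP; apply: eq_bigr => i _.
  by rewrite ffunE liftE liftK.
have dn : d ord_max = q`_n by rewrite dE coef_n.
pose d' : {ffun 'I_n -> A} := [ffun i => d (lift ord_max i)].
have cd : c = d'.
  apply: c_uniq; rewrite {1}dE big_ord_recr /= dn addrK.
  by apply: eq_bigr => i _; rewrite /d' ffunE liftE.
apply/ffunP => i; rewrite ffunE; case: unliftP => [j|] ->; last by rewrite dn.
by rewrite cd ffunE.
Qed.

(** * Closed subschemes of the affine line *)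

Section Quotients.
Variable R : comUnitRingType.
Implicit Types T : tring R.

Definition pev T (y : T) (q : {poly R}) : T := ev (tstr T) y q.

Lemma tmor_pev T T' (u : thom T T') (y : T) q : u (pev y q) = pev (u y) q.
Proof. by apply: rmorph_ev => a; apply: tmor_str. Qed.

Lemma tring_trivial T T' (u : thom T T') (a b : T') : 1 = 0 :> T -> a = b.
Proof.
move=> e; apply: trivial_ring.
by rewrite -(rmorph1 u) e rmorph0.
Qed.

Lemma maxpow_prod n (b : 'I_n -> R) :
  (forall j, maxideal (b j)) -> maxpow n (\prod_(j < n) b j).
Proof.
move=> mb; exists 1%N, (fun=> 1), (fun=> b); split=> //.
by rewrite big_ord1 mul1r.
Qed.

Definition distinguished (n : nat) (D : {poly R}) :=
  [/\ D \is monic, size D = n.+1 & forall i, (i < n)%N -> maxideal D`_i].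

Lemma distinguished_coef n D : distinguished n D -> D`_n = 1.
Proof. by move=> [mD sD _]; move: mD; rewrite monicE lead_coefE sD => /eqP. Qed.

(** At a root, y^n is a combination of lower powers with coefficients in the maximal ideal, so y^(n
    M) has coefficients in its M-th power, which [tstr_cont] kills for some M. Thus {D = 0} lies in
    the formal line. *)
Lemma distinguished_root n D T (y : T) :
  distinguished n D -> pev y D = 0 -> nilpotent_elt y.
Proof.
move=> dD; have D1 := distinguished_coef dD; case: dD => [mD sD dD].
rewrite /pev (@ev_widen _ _ _ _ n.+1) ?sD // big_ord_recr /= D1 rmorph1 mul1r.
move=> /eqP; rewrite addrC addr_eq0 => /eqP yn.
have [M kerM] := tstr_cont T; exists (n * M)%N.
pose F (j : 'I_M) (i : 'I_n) := tstr T (- D`_i) * y ^+ i.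
have -> : y ^+ (n * M) = \prod_j \sum_i F j i.
  rewrite exprM yn -sumrN /F big_const_ord iter_mulr_1.
  by congr (_ ^+ _); apply: eq_bigr => i _; rewrite /F rmorphN mulNr.
rewrite bigA_distr_bigA big1 // => f _; rewrite big_split /=.
rewrite -rmorph_prod kerM ?mul0r //; apply: maxpow_prod => j.
by rewrite /maxideal /= unitrN; apply: dD.
Qed.

(* [s] is the universal point of the closed subscheme D = 0 of the affine     *)
(* line over [T]; uniqueness of [v] will follow from [free_basis].            *)
Definition universal_root T (D : {poly R}) (B : tring R) (i : thom T B)
    (s : B) :=
  pev s D = 0 /\ forall T' (u : thom T T') (y : T'), pev y D = 0 ->
    exists v : thom B T', thom_comp v i = u /\ v s = y.

Definition free_basis T (B : tring R) (i : thom T B) n (e : 'I_n -> B) :=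
  forall b, exists! c : {ffun 'I_n -> T}, b = \sum_(j < n) i (c j) * e j.

Section NonTrivial.
Variables (K : comNzRingType) (tau : {rmorphism R -> K}).
Hypothesis tau_cont : exists n, forall a, maxpow n a -> tau a = 0.
Variables (n : nat) (D : {poly R}).
Hypothesis dD : distinguished n.+1 D.

Let DK := map_poly tau D.

Let DK_monic : DK \is monic.
Proof. by apply: monic_map; case: dD. Qed.

Let size_DK : size DK = n.+2.
Proof.
case: dD => mD sD _; rewrite size_map_poly_id0 //.
by rewrite (monicP mD) rmorph1 oner_eq0.
Qed.

(** The quotient [{poly %/ DK}] is by [mk_monic DK], which is [DK] only in positive degree; hence
    the [n.+1]. *)
Let mk_DK : mk_monic DK = DK.
Proof. by rewrite /mk_monic size_DK DK_monic. Qed.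

Let tauB : {rmorphism R -> {poly %/ DK}} := qpolyC DK \o tau.

Let tauB_cont : exists n, forall a, maxpow n a -> tauB a = 0.
Proof.
by case: tau_cont => m tau0; exists m => a /tau0 /= ->; rewrite rmorph0.
Qed.

Let T := TRing tau_cont.
Let B : tring R := TRing tauB_cont.

Let iota : thom T B := @THom R T B (qpolyC DK) (fun=> erefl).

Let s : B := in_qpoly DK 'X.

Let ev_iota (q : {poly K}) : ev iota s q = in_qpoly DK q.
Proof.
rewrite /ev -[in RHS](coefK q) poly_def rmorph_sum; apply: eq_bigr => i _.
rewrite -mul_polyC rmorphM rmorphXn; congr (_ * _); apply: val_inj => /=.
rewrite Pdiv.CommonRing.rmodp_small // mk_DK size_DK.
by rewrite ltnS (leq_trans (size_polyC_leq1 _)).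
Qed.

Let pev_iota (q : {poly R}) : pev s q = in_qpoly DK (map_poly tau q).
Proof.
rewrite -ev_iota [RHS](@ev_widen _ _ _ _ (size q)) ?size_poly //.
by apply: eq_bigr => i _; rewrite coef_map.
Qed.

(** [B] is K[X]/(D) and [s] the class of X. Reduced representatives have degree at most n, so
    [graded_basis] gives the bases. *)
Lemma nontrivial_universal_root : exists (B : tring R) (i : thom T B) (s : B),
  universal_root D i s /\ forall P, graded n.+1 P ->
    free_basis i (fun j : 'I_n.+1 => pev s (P j)).
Proof.
exists B, iota, s; split; [split |].
- rewrite pev_iota; apply: val_inj => /=.
  by rewrite mk_DK Pdiv.RingMonic.rmodpp.
- move=> T' u y Dy; pose f (b : {poly %/ DK}) : T' := ev u y b.
  have DK0 : ev u y DK = 0.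
    rewrite -Dy /pev [LHS](@ev_widen _ _ _ _ (size D)) ?size_poly //.
    apply: eq_bigr => i _; rewrite coef_map; congr (_ * _).
    exact: (tmor_str u).
  have f_in q : f (in_qpoly DK q) = ev u y q.
    rewrite /f /= mk_DK {2}[q](Pdiv.RingMonic.rdivp_eq DK_monic).
    by rewrite rmorphD rmorphM /= DK0 mulr0 add0r.
  have fD : zmod_morphism f by move=> a b; rewrite /f -rmorphB.
  have fM : monoid_morphism f.
    split=> [|a b]; first by rewrite /f evC rmorph1.
    have -> : a * b = in_qpoly DK ((a : {poly K}) * (b : {poly K})) by [].
    by rewrite f_in rmorphM.
  pose fa := GRing.isZmodMorphism.Build _ _ f fD.
  pose fm := GRing.isMonoidMorphism.Build _ _ f fM.
  pose F : {rmorphism {poly %/ DK} -> T'} := HB.pack f fa fm.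
  have Fstr a : F (tstr B a) = tstr T' a.
    by rewrite /= /f evC; apply: (tmor_str u).
  exists (@THom R B T' F Fstr); split.
    by apply: thom_eq => t /=; rewrite /f evC.
  by rewrite /= f_in evX.
- move=> P gP b; have gPK : graded n.+1 (fun i => map_poly tau (P i)).
    move=> i lt_i; have [mP sP] := gP _ lt_i; split; first exact: monic_map.
    by rewrite size_map_poly_id0 // (monicP mP) rmorph1 oner_eq0.
  have sb : (size (b : {poly K}) <= n.+1)%N.
    by rewrite -ltnS (leq_trans (size_mk_monic b)) // mk_DK size_DK.
  have sumE (c : 'I_n.+1 -> K) : \sum_(j < n.+1) c j *: map_poly tau (P j) =
      \sum_(j < n.+1) iota (c j) * pev s (P j) :> {poly K}.
    rewrite -[LHS](@in_qpoly_small _ DK); last first.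
      rewrite mk_DK size_DK ltnS (leq_trans (size_sum _ _ _)) //.
      apply/bigmax_leqP => j _; rewrite (leq_trans (size_scale_leq _ _)) //.
      by rewrite (gPK j _).2.
    congr polyn; rewrite rmorph_sum; apply: eq_bigr => j _.
    rewrite -mul_polyC rmorphM pev_iota; congr (_ * _).
    by have := ev_iota (c j)%:P; rewrite evC => /esym.
  have [c [cE c_uniq]] := graded_basis gPK sb.
  exists c; split=> [|d dE]; first exact: val_inj (etrans cE (sumE c)).
  by apply: c_uniq; rewrite sumE [in LHS]dE.
Qed.
End NonTrivial.

Lemma universal_rootP T (D : {poly R}) n : distinguished n.+1 D ->
  exists (B : tring R) (i : thom T B) (s : B),
    universal_root D i s /\ forall P, graded n.+1 P ->
      free_basis i (fun j : 'I_n.+1 => pev s (P j)).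
Proof.
move=> dD; have [T1|T1] := eqVneq (1 : T) 0.
  (* Every ring over the zero ring is zero, so [T] itself is universal. *)
  exists T, (thom_id T), 0; split; [split|].
  - exact: trivial_ring.
  - move=> T' u y _; exists u; split; first exact: thom_eq.
    exact: (tring_trivial u).
  move=> P _ b; exists [ffun=> 0]; split=> [|c _]; first exact: trivial_ring.
  by apply/ffunP => j; apply: trivial_ring.
case: T T1 => C tau tau_cont /= C1; have [K KC] := comNzRing_of_nontrivial C1.
case: _ / KC tau tau_cont {C1} => tau tau_cont.
exact: nontrivial_universal_root.
Qed.

End Quotients.

(** * Expansions of natural functions and Weierstrass division *)

Section NaturalFunctions.
Variable R : comUnitRingType.
Implicit Types (T : tring R) (D W : {poly R}).

Lemma thom_compE T T' T'' (v : thom T' T'') (u : thom T T') (w : thom T T'') a :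
  thom_comp v u = w -> v (u a) = w a.
Proof. by move=> <-. Qed.

Definition natural_on T (C : forall T', T' -> Prop)
    (phi : forall T', thom T T' -> T' -> T') :=
  forall T' T'' (v : thom T' T'') (u : thom T T') (y : T'), C T' y ->
    phi T'' (thom_comp v u) (v y) = v (phi T' u y).

(** Yoneda: [phi] is determined by its value at the universal root, an element of a free
    T-module. *)
Lemma expansion T n D (P : nat -> {poly R})
    (phi : forall T', thom T T' -> T' -> T') :
  distinguished n.+1 D -> graded n.+1 P ->
  natural_on (fun T' y => pev y D = 0) phi ->
  exists! c : {ffun 'I_n.+1 -> T}, forall T' (u : thom T T') (y : T'),
    pev y D = 0 -> phi T' u y = \sum_(j < n.+1) u (c j) * pev y (P j).
Proof.
move=> dD gP nphi.
have [B [i [s [[Ds univ] /(_ P gP) basis]]]] := universal_rootP T dD.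
have [c [cE c_uniq]] := basis (phi B i s).
exists c; split=> [T' u y Dy|d dE]; last by apply: c_uniq; apply: dE.
have [v [<- <-]] := univ T' u y Dy.
rewrite nphi // cE rmorph_sum; apply: eq_bigr => j _.
by rewrite rmorphM tmor_pev.
Qed.

(** For W of degree N, the first N of these form a basis modulo W, and the first N + k a basis
    modulo X^k W. *)
Definition wbasis N W i : {poly R} :=
  if (i < N)%N then 'X^i else 'X^(i - N) * W.

Lemma pev_XnM T (y : T) k W : pev y ('X^k * W) = y ^+ k * pev y W.
Proof. by rewrite /pev rmorphM /= evXn. Qed.

Lemma wbasis_low N W i T (y : T) : (i < N)%N -> pev y (wbasis N W i) = y ^+ i.
Proof. by rewrite /wbasis => ->; rewrite /pev evXn. Qed.

Lemma wbasis_high N W i T (y : T) :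
  pev y (wbasis N W (N + i)) = y ^+ i * pev y W.
Proof. by rewrite /wbasis ltnNge leq_addr addKn pev_XnM. Qed.

Lemma distinguished_XnM N k W :
  distinguished N W -> distinguished (N + k) ('X^k * W).
Proof.
move=> [mW sW W0]; split; first by rewrite monicMl ?monicXn.
  by rewrite mulrC size_mulXn ?monic_neq0 // sW addnS addnC.
move=> i lt_i; rewrite coefXnM; case: ltnP => [_|le_k].
  by rewrite /maxideal /= unitr0.
by apply: W0; rewrite ltn_subLR // addnC.
Qed.

Lemma graded_wbasis N W n : distinguished N W -> graded n (wbasis N W).
Proof.
move=> dW i _; rewrite /wbasis; case: ltnP => [_|le_i].
  by rewrite monicXn size_polyXn.
have [mW -> _] := distinguished_XnM (i - N) dW.
by rewrite subnKC.
Qed.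

(* Weierstrass division by W of the functions on the formal affine line: the  *)
(* remainder collects the [c i] with [i < N], the quotient the other ones.    *)
Lemma weierstrass_division T N W (phi : forall T', thom T T' -> T' -> T') :
  distinguished N.+1 W -> natural_on (fun T' => @nilpotent_elt T') phi ->
  exists! c : nat -> T, forall T' (u : thom T T') (y : T') k,
    y ^+ k * pev y W = 0 ->
    phi T' u y = \sum_(i < N.+1 + k) u (c i) * pev y (wbasis N.+1 W i).
Proof.
move=> dW nphi.
have dWk k := distinguished_XnM k dW.
have nphik k : natural_on (fun T' y => pev y ('X^k * W) = 0) phi.
  move=> T' T'' v u y /(distinguished_root (dWk k)); exact: nphi.
have ex k := expansion (dWk k) (@graded_wbasis _ _ (N.+1 + k) dW) (nphik k).
(* Coefficients are reindexed by [nat], so that those for different k can be compared. *)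
have {}ex k : exists c : nat -> T,
    (forall T' (u : thom T T') (y : T'), y ^+ k * pev y W = 0 ->
      phi T' u y = \sum_(j < N.+1 + k) u (c j) * pev y (wbasis N.+1 W j)) /\
    (forall d : nat -> T,
    (forall T' (u : thom T T') (y : T'), y ^+ k * pev y W = 0 ->
      phi T' u y = \sum_(j < N.+1 + k) u (d j) * pev y (wbasis N.+1 W j)) ->
      forall j, (j < N.+1 + k)%N -> c j = d j).
  have [c [cE c_uniq]] := ex k.
  exists (fun j => if insub j is Some i then c i else 0); split=> [T' u y|d dE].
    rewrite -pev_XnM => /cE ->; apply: eq_bigr => j _.
    rewrite (insubT (fun i => i < N.+1 + k)%N (ltn_ord j)) /=.
    by congr (u (c _) * _); apply: val_inj.
  have cd : c = [ffun j : 'I_(N.+1 + k) => d j].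
    apply: c_uniq => T' u y; rewrite pev_XnM => /dE ->.
    by apply: eq_bigr => j _; rewrite ffunE.
  by move=> j lt_j; rewrite (insubT (fun i => i < N.+1 + k)%N lt_j) cd ffunE.
have /choice[e eP] := ex.
(* Restriction from {X^(k+1) W = 0} to {X^k W = 0} kills the last basis element X^k W and keeps the
   others. *)
have coh k j : (j < N.+1 + k)%N -> e k.+1 j = e k j.
  move=> lt_j; apply/esym; apply: (eP k).2 lt_j => T' u y yk.
  have yk1 : y ^+ k.+1 * pev y W = 0 by rewrite exprS -mulrA yk mulr0.
  rewrite (eP k.+1).1 // addnS big_ord_recr /= wbasis_high yk mulr0 addr0.
  by [].
have coh' k l j : (k <= l)%N -> (j < N.+1 + k)%N -> e l j = e k j.
  elim: l => [|l IH]; first by rewrite leqn0 => /eqP ->.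
  rewrite leq_eqVlt => /predU1P[-> //|le_kl] lt_j.
  by rewrite coh ?IH // (leq_trans lt_j) // leq_add2l.
(* The coefficient of index j is stable from k = j on. *)
pose c j := e j j.
have cE k j : (j < N.+1 + k)%N -> c j = e k j.
  move=> lt_j; rewrite /c; have [le_jk|/ltnW le_kj] := leqP j k.
    by rewrite (coh' j k) // addSn ltnS leq_addl.
  by rewrite (coh' k j).
exists c; split=> [T' u y k yk|d dE].
  by rewrite (eP k).1 //; apply: eq_bigr => j _; rewrite -cE.
apply: funext => j; apply: (eP j).2 => [T' u y|]; first exact: dE.
by rewrite addSn ltnS leq_addl.
Qed.

Lemma distinguishedX : distinguished 1 ('X : {poly R}).
Proof.
split=> [||[|//] _]; rewrite ?monicX ?size_polyX //.
by rewrite coefX /maxideal /= unitr0.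
Qed.

Lemma pev_wbasisX T (y : T) i : pev y (wbasis 1 'X i) = y ^+ i.
Proof.
case: i => [|i]; first by rewrite wbasis_low.
by rewrite -add1n wbasis_high /pev evX -exprSr.
Qed.

(** This is Weierstrass division by W = X, whose adapted basis consists of the powers of X. *)
Lemma power_series T (phi : forall T', thom T T' -> T' -> T') :
  natural_on (fun T' => @nilpotent_elt T') phi ->
  exists! c : nat -> T, forall T' (u : thom T T') (y : T') k, y ^+ k = 0 ->
    phi T' u y = \sum_(i < k) u (c i) * y ^+ i.
Proof.
move=> nphi; have [c [cE c_uniq]] := weierstrass_division distinguishedX nphi.
have sumE (d : nat -> T) T' (u : thom T T') (y : T') k :
    \sum_(i < 1 + k) u (d i) * pev y (wbasis 1 'X i) =
    \sum_(i < k.+1) u (d i) * y ^+ i.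
  by apply: eq_bigr => i _; rewrite pev_wbasisX.
exists c; split=> [T' u y [|k] yk|d dE].
(* For k = 0 the hypothesis reads 1 = 0. *)
- by apply: trivial_ring; rewrite -yk expr0.
- by rewrite (cE _ _ _ k) ?sumE // /pev evX -exprSr.
apply: c_uniq => T' u y k; rewrite /pev evX -exprSr sumE; exact: dE.
Qed.

End NaturalFunctions.

(** * Power series and Weierstrass preparation *)

Definition series (A : comNzRingType) := nat -> A.

Section SeriesRing.
Variable A : comNzRingType.
Implicit Types f g h : series A.

HB.instance Definition _ := gen_eqMixin (series A).
HB.instance Definition _ := gen_choiceMixin (series A).

Definition series_zero : series A := fun=> 0.
Definition series_opp f : series A := fun n => - f n.
Definition series_add f g : series A := fun n => f n + g n.

Lemma series_addA : associative series_add.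
Proof. by move=> f g h; apply: funext => n; rewrite /series_add addrA. Qed.
Lemma series_addC : commutative series_add.
Proof. by move=> f g; apply: funext => n; rewrite /series_add addrC. Qed.
Lemma series_add0 : left_id series_zero series_add.
Proof. by move=> f; apply: funext => n; rewrite /series_add add0r. Qed.
Lemma series_addN : left_inverse series_zero series_opp series_add.
Proof. by move=> f; apply: funext => n; rewrite /series_add addNr. Qed.

HB.instance Definition _ := GRing.isZmodule.Build (series A)
  series_addA series_addC series_add0 series_addN.

Definition truncation k f : {poly A} := \poly_(i < k) f i.

Definition series_one : series A := fun n => (n == 0%N)%:R.
Definition series_mul f g : series A :=
  fun n => \sum_(j < n.+1) f j * g (n - j)%N.

Lemma series_mulE k n f g : (n < k)%N ->
  series_mul f g n = (truncation k f * truncation k g)`_n.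
Proof.
move=> lt_nk; rewrite coefM; apply: eq_bigr => j _; rewrite !coef_poly.
by rewrite (leq_trans (ltn_ord j) lt_nk) (leq_ltn_trans (leq_subr _ _) lt_nk).
Qed.

Lemma series_mulC : commutative series_mul.
Proof.
by move=> f g; apply: funext => n; rewrite !(@series_mulE n.+1) // mulrC.
Qed.

Lemma series_mulA : associative series_mul.
Proof.
have assoc f g h n : series_mul f (series_mul g h) n =
    (truncation n.+1 f * (truncation n.+1 g * truncation n.+1 h))`_n.
  rewrite coefM; apply: eq_bigr => j _; rewrite coef_poly ltn_ord.
  by rewrite (@series_mulE n.+1) // ltnS leq_subr.
move=> f g h; apply: funext => n.
by rewrite assoc series_mulC assoc mulrA mulrC.
Qed.

Lemma series_mul1 : left_id series_one series_mul.
Proof.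
move=> f; apply: funext => n; rewrite /series_mul big_ord_recl mul1r subn0.
by rewrite big1 ?addr0 // => i _; rewrite mul0r.
Qed.

Lemma series_mulDl : left_distributive series_mul series_add.
Proof.
move=> f g h; apply: funext => n; rewrite /series_add /series_mul -big_split.
by apply: eq_bigr => i _; rewrite mulrDl.
Qed.

Lemma series_one_neq0 : series_one != series_zero.
Proof. by apply/eqP => /(congr1 (fun f => f 0%N)) /eqP; rewrite oner_eq0. Qed.

HB.instance Definition _ := GRing.Zmodule_isComNzRing.Build (series A)
  series_mulA series_mulC series_mul1 series_mulDl series_one_neq0.

Lemma series_addE f g n : (f + g) n = f n + g n. Proof. by []. Qed.
Lemma series_oppE f n : (- f) n = - f n. Proof. by []. Qed.
Lemma series_mulfE f g n : (f * g) n = \sum_(j < n.+1) f j * g (n - j)%N.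
Proof. by []. Qed.

Definition seriesXn k : series A := fun n => (n == k)%:R.

Lemma seriesXnM k f n :
  (seriesXn k * f) n = if (n < k)%N then 0 else f (n - k)%N.
Proof.
rewrite series_mulfE; case: ltnP => [lt_nk|le_kn].
  rewrite big1 // => j _; rewrite /seriesXn ltn_eqF ?mul0r //.
  by rewrite (leq_trans (ltn_ord j)).
rewrite (bigD1 (Ordinal (le_kn : (k < n.+1)%N))) //= /seriesXn eqxx mul1r.
rewrite big1 ?addr0 // => j; rewrite -val_eqE /= => /negbTE ->.
by rewrite mul0r.
Qed.

Definition series_shift k f : series A := fun n => f (k + n)%N.

Definition series_poly (q : {poly A}) : series A := fun n => q`_n.

End SeriesRing.

Lemma series_inverse (A : comUnitRingType) (f : series A) :
  f 0%N \is a GRing.unit -> exists g : series A, f * g = 1.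
Proof.
move=> f0.
(* Each coefficient of the inverse depends on all the previous ones, which are accumulated in a
   list. *)
pose next (s : seq A) :=
  rcons s ((f 0%N)^-1 *
    ((size s == 0%N)%:R - \sum_(j < size s) s`_j * f (size s - j)%N)).
pose s n := iter n next [::].
have size_s n : size (s n) = n by elim: n => //= n IH; rewrite size_rcons IH.
pose g n := (s n.+1)`_n.
have nth_s n j : (j < n)%N -> (s n)`_j = g j.
  elim: n => // n IH; rewrite ltnS leq_eqVlt => /predU1P[-> //|lt_jn].
  by rewrite /= nth_rcons size_s lt_jn IH.
exists (g : series A); rewrite mulrC; apply: funext => n.
rewrite series_mulfE big_ord_recr /= subnn.
have -> : g n = (f 0%N)^-1 * ((n == 0%N)%:R - \sum_(j < n) g j * f (n - j)%N).
  rewrite /g /= nth_rcons size_s ltnn eqxx; congr (_ * (_ - _)).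
  by apply: eq_bigr => j _; rewrite nth_s.
by rewrite mulrC mulrA divrr // mul1r addrC subrK.
Qed.

Section Weierstrass.
Variable R : comUnitRingType.
Hypothesis complete_R : complete_local_ring R.

Let local_R : local_ring R. Proof. by case: complete_R. Qed.

Lemma maxpowMl n (a x : R) : maxpow n x -> maxpow n (a * x).
Proof.
by move=> mx; rewrite -[_ * _]addr0; apply: maxpow_closed (maxpow0 _ _).
Qed.

Lemma maxpowD n (x y : R) : maxpow n x -> maxpow n y -> maxpow n (x + y).
Proof. by move=> mx my; rewrite -[x]mul1r; apply: maxpow_closed. Qed.

Lemma maxpow_sum n (I : Type) (r : seq I) (P : pred I) (F : I -> R) :
  (forall i, P i -> maxpow n (F i)) -> maxpow n (\sum_(i <- r | P i) F i).
Proof.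
by move=> mF; apply: big_ind => //; [apply: maxpow0 | apply: maxpowD].
Qed.

Lemma maxpowS n (a x : R) : maxideal a -> maxpow n x -> maxpow n.+1 (a * x).
Proof.
move=> ma [k [c [b [mb ->]]]].
exists k, c, (fun i j => if unlift ord0 j is Some j' then b i j' else a).
split=> [i j|]; first by case: unliftP => [j' _|_].
rewrite mulr_sumr; apply: eq_bigr => i _.
rewrite big_ord_recl unlift_none mulrCA; congr (_ * (_ * _)).
by apply: eq_bigr => j _; rewrite liftK.
Qed.

Lemma maxideal0 : maxideal (0 : R).
Proof. by rewrite /maxideal /= unitr0. Qed.

Lemma maxidealD (a b : R) : maxideal a -> maxideal b -> maxideal (a + b).
Proof. by move=> /negP ma /negP mb; apply/negP => /local_R[]. Qed.

Lemma maxidealMl (a b : R) : maxideal b -> maxideal (a * b).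
Proof.
by move=> mb; rewrite /maxideal /= unitrM negb_and; apply/orP; right.
Qed.

Lemma maxideal_sum (I : Type) (r : seq I) (P : pred I) (F : I -> R) :
  (forall i, P i -> maxideal (F i)) -> maxideal (\sum_(i <- r | P i) F i).
Proof.
move=> mF; apply: (@big_ind _ (@maxideal R)) => //; first exact: maxideal0.
exact: maxidealD.
Qed.

Lemma weierstrass_preparation n (f : series R) :
  (forall i, (i < n)%N -> maxideal (f i)) -> f n \is a GRing.unit ->
  exists (V : {poly R}) (g h : series R),
    [/\ distinguished n V, g * h = 1 & series_poly V = g * f].
Proof.
move=> mf uf; have [_ sep_R cpl_R] := complete_R.
pose L : series R := fun i => if (i < n)%N then f i else 0.
pose H := series_shift n f.
have fE : f = L + seriesXn R n * H.
  apply: funext => i; rewrite series_addE seriesXnM /L /H /series_shift.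
  by case: ltnP => [_|le_ni]; rewrite ?addr0 ?add0r ?subnKC.
(* With M = L / H, which has its coefficients in the maximal ideal, the       *)
(* cofactor g = Z / H makes g f = Z M + Z X^n a monic polynomial of degree n  *)
(* when the coefficients of Z M from X^n on cancel those of Z - 1; such a Z   *)
(* is the fixed point of a contraction.                                       *)
have [H' HH'] : exists H', H * H' = 1.
  by apply: series_inverse; rewrite /H /series_shift addn0.
pose M := H' * L.
have mM i : maxideal (M i).
  rewrite /M series_mulfE; apply: maxideal_sum => j _; apply: maxidealMl.
  by rewrite /L; case: ifP => [/mf|_] //; apply: maxideal0.
pose step (Z : series R) : series R := 1 - series_shift n (Z * M).
have stepE Z i : step Z i = (1 : series R) i - (Z * M) (n + i)%N by [].
have stepB Z1 Z2 i : step Z1 i - step Z2 i = - ((Z1 - Z2) * M) (n + i)%N.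
  rewrite !stepE mulrBl series_addE series_oppE !opprD !opprK addrACA subrr.
  by rewrite add0r.
pose Z_ k := iter k step 0.
have Z_cauchy k i : maxpow k (Z_ k.+1 i - Z_ k i).
  elim: k i => [|k IH] i.
    exists 1%N, (fun=> Z_ 1 i - Z_ 0 i), (fun _ _ => 0).
    by rewrite big_ord1 big_ord0 mulr1; split => // ? [].
  rewrite [X in X - _]/(step (Z_ k.+1) i) [X in _ - X]/(step (Z_ k) i) stepB.
  rewrite -mulN1r; apply: maxpowMl.
  rewrite series_mulfE; apply: maxpow_sum => j _.
  by rewrite mulrC; apply: maxpowS; [apply: mM | apply: IH].
have /choice[Z0 Zlim0] : forall i, exists l, forall k, maxpow k (l - Z_ k i).
  by move=> i; apply: cpl_R => k; apply: Z_cauchy.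
have [Z Zlim] : exists Z : series R, forall i k, maxpow k (Z i - Z_ k i).
  by exists Z0.
move: Z Zlim {Z0 Zlim0} => Z Zlim.
have ZE : Z = step Z.
  apply: funext => i; apply/eqP; rewrite -subr_eq0; apply/eqP/sep_R => k.
  rewrite -[Z i](subrK (Z_ k.+1 i)) -addrA; apply: maxpowD.
    exact: maxpow_le (leqnSn k) (Zlim i k.+1).
  rewrite [X in X - _]/(step (Z_ k) i) stepB -series_oppE -mulNr opprB mulrC.
  rewrite series_mulfE; apply: maxpow_sum => j _.
  by apply: maxpowMl; apply: Zlim.
have ZM i : maxideal ((Z * M) i).
  by rewrite series_mulfE; apply: maxideal_sum => j _; apply: maxidealMl.
(* The fixed point equation gives Z_0 + (Z M)_n = 1, where the second term is in the maximal
   ideal. *)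
have Z0 : Z 0%N \is a GRing.unit.
  have /local_R[] // : Z 0%N + (Z * M) n \is a GRing.unit.
    by rewrite {1}ZE stepE addn0 subrK unitr1.
  by move=> uZM; have := ZM n; rewrite /maxideal /= uZM.
have [Z' ZZ'] := series_inverse Z0.
pose V : {poly R} := 'X^n + \poly_(i < n) (Z * M) i.
have VE i : V`_i = if (i < n)%N then (Z * M) i else (i == n)%:R.
  rewrite coefD coefXn coef_poly; case: ltnP => [lt_in|_]; rewrite ?addr0 //.
  by rewrite ltn_eqF ?add0r.
have sV : (size (\poly_(i < n) (Z * M) i)%R < size ('X^n : {poly R})%R)%N.
  by rewrite size_polyXn ltnS size_poly.
exists V, (Z * H'), (Z' * H); split.
- split; first by rewrite monicE lead_coefDl // lead_coefXn.
    by rewrite size_polyDl // size_polyXn.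
  by move=> i lt_in; rewrite VE lt_in.
- by rewrite mulrACA ZZ' mul1r mulrC.
apply: funext => i; rewrite -[LHS]/(V`_i) VE fE mulrDr.
rewrite -[Z * H' * L]mulrA -/M [Z * H' * _]mulrCA.
rewrite -[Z * H' * H]mulrA [H' * H]mulrC HH' mulr1.
rewrite series_addE seriesXnM; case: ltnP => [_|le_ni]; first by rewrite addr0.
have -> : Z (i - n)%N = step Z (i - n)%N by rewrite -ZE.
rewrite stepE subnKC // addrC subrK.
by rewrite -[(1 : series R) _]/(_ == 0%N)%:R subn_eq0 eqn_leq le_ni andbT.
Qed.

End Weierstrass.

(** * Functions on the formal line *)

Section PowerSums.
Implicit Types C : comPzRingType.

(** A chosen exponent that kills [t]; by [psumE], [psum] does not depend on the choice. *)
Definition nilpotency_bound C (t : C) : nat :=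
  if pselect (nilpotent_elt t) is left e then sval (cid e) else 0.

(* 0 if [t] is not nilpotent *)
Definition psum C (c : nat -> C) (t : C) : C :=
  \sum_(i < nilpotency_bound t) c i * t ^+ i.

Lemma psumE C (c : nat -> C) (t : C) k :
  t ^+ k = 0 -> psum c t = \sum_(i < k) c i * t ^+ i.
Proof.
have widen m n : (m <= n)%N -> t ^+ m = 0 ->
    \sum_(i < m) c i * t ^+ i = \sum_(i < n) c i * t ^+ i.
  move=> le_mn tm; rewrite (big_ord_widen n (fun i => c i * t ^+ i) le_mn).
  rewrite big_mkcond; apply: eq_bigr => i _; case: ltnP => // le_mi.
  by rewrite (nilpotentX_ge le_mi tm) mulr0.
rewrite /psum /nilpotency_bound => tk.
case: pselect => [e|[]]; last by exists k.
case: (cid e) => m /= tm.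
by case: (leqP m k) => [|/ltnW] le_mk; [apply: widen | apply/esym/widen].
Qed.

Lemma psum0 C (c : nat -> C) : psum c 0 = c 0%N.
Proof. by rewrite (@psumE _ _ _ 1) ?expr1 // big_ord1 mulr1. Qed.

Lemma psumS C (c : nat -> C) (t : C) : nilpotent_elt t ->
  psum c t = c 0%N + t * psum (fun i => c i.+1) t.
Proof.
move=> [k tk]; rewrite (@psumE _ c _ k.+1); last by rewrite exprS tk mulr0.
rewrite (psumE _ tk).
rewrite big_ord_recl mulr1 mulr_sumr; congr (_ + _); apply: eq_bigr => i _.
by rewrite /= exprS mulrCA.
Qed.

Lemma rmorph_psum C C' (u : {rmorphism C -> C'}) (c : nat -> C) (t : C) :
  nilpotent_elt t -> u (psum c t) = psum (fun i => u (c i)) (u t).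
Proof.
move=> [k tk]; rewrite (psumE _ tk) (@psumE _ _ _ k); last first.
  by rewrite -rmorphXn tk rmorph0.
by rewrite rmorph_sum; apply: eq_bigr => i _; rewrite rmorphM rmorphXn.
Qed.

End PowerSums.

Section NaturalFunctions.
Variable R : comUnitRingType.
Implicit Types (T : tring R).

Definition sev T (y : T) (f : series R) : T := psum (fun i => tstr T (f i)) y.

Lemma tmor_sev T T' (u : thom T T') (y : T) f :
  nilpotent_elt y -> u (sev y f) = sev (u y) f.
Proof.
move=> ny; rewrite /sev rmorph_psum //; congr psum.
by apply: funext => i; apply: tmor_str.
Qed.

Lemma sev_truncation T (y : T) f k :
  y ^+ k = 0 -> sev y f = pev y (truncation k f).
Proof.
move=> yk; rewrite /sev (psumE _ yk) /pev (@ev_widen _ _ _ _ k) ?size_poly //.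
by apply: eq_bigr => i _; rewrite coef_poly ltn_ord.
Qed.

Lemma pev_high T (y : T) (q : {poly R}) k :
  y ^+ k = 0 -> (forall i, (i < k)%N -> q`_i = 0) -> pev y q = 0.
Proof.
move=> yk q0; rewrite /pev /ev big1 // => i _; have [lt_i|le_i] := ltnP i k.
  by rewrite q0 // rmorph0 mul0r.
by rewrite (nilpotentX_ge le_i yk) mulr0.
Qed.

Lemma sevM T (y : T) f g : nilpotent_elt y -> sev y (f * g) = sev y f * sev y g.
Proof.
move=> [k yk]; rewrite !(sev_truncation _ yk) -[RHS]rmorphM; apply/eqP.
rewrite -subr_eq0 -[_ - _]rmorphB; apply/eqP/(pev_high yk) => i lt_i.
by rewrite coefB coef_poly lt_i -(series_mulE _ _ lt_i) subrr.
Qed.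

Lemma sev1 T (y : T) : nilpotent_elt y -> sev y 1 = 1.
Proof.
move=> [k yk]; rewrite (@sev_truncation _ _ _ k.+1) ?exprS ?yk ?mulr0 //.
rewrite -[RHS](rmorph1 (ev (tstr T) y)); congr ev; apply/polyP => i.
rewrite coef_poly coef1; case: ltnP => //; by case: i.
Qed.

Lemma sev_poly T (y : T) q : nilpotent_elt y -> sev y (series_poly q) = pev y q.
Proof.
move=> [k yk]; rewrite (sev_truncation _ yk); apply/eqP.
rewrite -subr_eq0 -[_ - _]rmorphB; apply/eqP/(pev_high yk) => i lt_i.
by rewrite coefB coef_poly lt_i subrr.
Qed.

Lemma power_series0 T (c : nat -> T) :
  (forall T' (u : thom T T') (t : T') k, t ^+ k = 0 ->
    \sum_(i < k) u (c i) * t ^+ i = 0) -> forall i, c i = 0.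
Proof.
move=> c0.
have [|d [_ d_uniq]] := @power_series _ T (fun _ _ _ => 0).
  by move=> T' T'' v u y _; rewrite rmorph0.
have -> : c = fun=> 0; last by [].
rewrite -(d_uniq (fun=> 0)) => [|T' u t k tk].
  by apply/esym/d_uniq => T' u t k /c0.
by rewrite big1 // => i _; rewrite rmorph0 mul0r.
Qed.

Definition stable (C : forall T, T -> Prop) :=
  forall T T' (u : thom T T') (a : T), C T a -> C T' (u a).

Definition natural_in (C : forall T, T -> Prop) (phi : forall T, T -> T -> T) :=
  forall T T' (u : thom T T') (a t : T), C T a -> nilpotent_elt t ->
    phi T' (u a) (u t) = u (phi T a t).

Section Hadamard.
Variables (C : forall T, T -> Prop) (phi : forall T, T -> T -> T).
Hypotheses (C_stable : stable C) (phi_natural : natural_in C phi).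

Lemma natural_in_power_series T (a : T) : C a ->
  exists! c : nat -> T, forall T' (u : thom T T') (t : T') k, t ^+ k = 0 ->
    phi (u a) t = \sum_(i < k) u (c i) * t ^+ i.
Proof.
move=> Ca; apply: (@power_series _ T (fun T' u t => phi (u a) t)).
by move=> T' T'' v u t nt; exact: (phi_natural v (C_stable u Ca) nt).
Qed.

(** For fixed a, phi(a, -) is a power series; uniqueness makes its coefficients natural in a. [psi]
    is the series with the constant term dropped and the others shifted. *)
Lemma hadamard : exists psi : forall T, T -> T -> T, natural_in C psi /\
  forall T (a t : T), C a -> nilpotent_elt t ->
    phi a t = phi a 0 + t * psi T a t.
Proof.
pose P T (a : T) (c : nat -> T) := C a ->
  forall T' (u : thom T T') (t : T') k, t ^+ k = 0 ->
    phi (u a) t = \sum_(i < k) u (c i) * t ^+ i.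
have exP T (a : T) : exists c, P T a c.
  have [Ca|nCa] := pselect (C a); last by exists (fun=> 0).
  by have [c [cE _]] := natural_in_power_series Ca; exists c => _.
pose c T (a : T) := sval (cid (exP T a)).
have cP T (a : T) : P T a (c T a) by rewrite /c; case: cid.
have cE T (a t : T) : C a -> nilpotent_elt t -> phi a t = psum (c T a) t.
  move=> Ca [k tk]; rewrite (psumE _ tk).
  exact: (cP T a Ca T (thom_id T) t k tk).
have c_nat T T' (u : thom T T') (a : T) :
    C a -> c T' (u a) = fun i => u (c T a i).
  move=> Ca; have Cua := C_stable u Ca.
  have [d [_ d_uniq]] := natural_in_power_series Cua.
  rewrite -(d_uniq _ (cP _ _ Cua)); apply: d_uniq => T'' v t k tk.
  exact: (cP T a Ca T'' (thom_comp v u)).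
exists (fun T a => psum (fun i => c T a i.+1)); split.
  by move=> T T' u a t Ca nt; rewrite rmorph_psum // c_nat.
move=> T a t Ca nt; rewrite !cE //; last exact: nilpotent0.
by rewrite psum0 psumS.
Qed.

(** Multiplication by t shifts the coefficients of phi(a, -), and a series that vanishes at all
    nilpotent points is zero. *)
Lemma variable_regular :
  (forall T (a t : T), C a -> nilpotent_elt t -> t * phi a t = 0) ->
  forall T (a t : T), C a -> nilpotent_elt t -> phi a t = 0.
Proof.
move=> phi0 T a t Ca [k tk].
have [c [cE _]] := natural_in_power_series Ca.
have c0 i : c i = 0.
  apply: (@power_series0 T (fun i => if i is j.+1 then c j else 0) _ i.+1).
  move=> T' u y [|l] yl; first by rewrite big_ord0.
  rewrite big_ord_recl rmorph0 mul0r add0r.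
  have := phi0 T' (u a) y (C_stable u Ca) (ex_intro _ _ yl).
  rewrite (cE _ _ _ l.+1) // big_ord_recr mulrDr /= mulrCA -exprS yl.
  rewrite mulr0 addr0 mulr_sumr => e; rewrite -[RHS]e; apply: eq_bigr => j _.
  by rewrite /= exprS mulrCA.
rewrite (cE T (thom_id T) t k tk) big1 // => i _.
by rewrite c0 rmorph0 mul0r.
Qed.

End Hadamard.
End NaturalFunctions.

(** * Coordinates on a formal group *)

Section FormalGroups.
Variable R : comUnitRingType.
Hypothesis complete_R : complete_local_ring R.
Variable G : formal_group R.
Implicit Types T : tring R.

(** The family is viewed as a constant function on a Hom scheme, so that [zero_valueP] applies; the
    group ['Z_2] is an arbitrary choice. *)
Lemma global_function (c : forall T, T) :
  (forall T T' (u : thom T T'), c T' = u (c T)) ->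
  exists r, forall T, c T = tstr T r.
Proof.
move=> c_nat; pose X := hom_scheme G 'Z_2.
pose f : ofun (whole X) := @OFun R X (whole X) (fun T _ _ => c T)
  (fun T T' u _ _ _ => c_nat T T' u).
by exists (zero_value f) => T; rewrite -(zero_valueP f complete_R).
Qed.

Lemma tstr_eq0 (r : R) : (forall T, tstr T r = 0) -> r = 0.
Proof.
by move=> r0; apply: zero_value_unique => // T; rewrite r0 rmorph0.
Qed.

Variables (x : forall T, G T -> T).
Hypothesis coord_x : coordinate x.

Lemma coord_nilpotent T (g : G T) : nilpotent_elt (x g).
Proof. by apply/(coord_im coord_x); exists g. Qed.

(** The inverse of the coordinate, with default value 0 when [y] is not nilpotent. *)
Definition of_coord T (y : T) : G T := xget 0 [set g | x g = y]%classic.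

Lemma of_coordK T (y : T) : nilpotent_elt y -> x (of_coord y) = y.
Proof.
move=> /(coord_im coord_x)[g xg].
exact: (xgetPex 0 (P := [set g | x g = y]%classic) (ex_intro _ g xg)).
Qed.

Lemma coordK T (g : G T) : of_coord (x g) = g.
Proof.
by apply: (coord_inj coord_x); rewrite of_coordK //; apply: coord_nilpotent.
Qed.

Lemma amap_of_coord T T' (u : thom T T') (y : T) : nilpotent_elt y ->
  amap u (of_coord y) = of_coord (u y).
Proof.
move=> ny; apply: (coord_inj coord_x).
rewrite (coord_nat coord_x) !of_coordK //.
exact: nilpotent_rmorph.
Qed.

Lemma of_coord0 T : of_coord (0 : T) = 0.
Proof. apply: (coord_inj coord_x); rewrite (Defs.coord0 coord_x) of_coordK //.
exact: nilpotent0. Qed.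

Lemma stable_nilpotent : stable (fun T => @nilpotent_elt T).
Proof. by move=> T T' u a; apply: nilpotent_rmorph. Qed.

(* The formal group law is X + Y (1 + X E(X, Y)).                             *)
Lemma coordD T (g h : G T) : exists e, x (g + h) = x g + x h * (1 + x g * e).
Proof.
pose phi T (a t : T) := x (of_coord a + of_coord t).
have phi_nat : natural_in (fun T => @nilpotent_elt T) phi.
  move=> T1 T2 u a t na nt.
  by rewrite /phi -!amap_of_coord // -raddfD (coord_nat coord_x).
have [psi [psi_nat phiE]] := hadamard stable_nilpotent phi_nat.
have psi_nat' : natural_in (fun T => @nilpotent_elt T) (fun T t a => psi T a t).
  by move=> T1 T2 u a t na nt; apply: psi_nat.
have [chi [_ psiE]] := hadamard stable_nilpotent psi_nat'.
(* Since x(0 + t) = t, one has t (psi(0, t) - 1) = 0, and t can be cancelled. *)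
have psi0 T1 (t : T1) : nilpotent_elt t -> psi T1 0 t = 1.
  move=> nt; apply/eqP; rewrite -subr_eq0; apply/eqP.
  apply: (@variable_regular _ (fun T => @nilpotent_elt T)
    (fun T a t => psi T 0 t - 1)) nt => //.
  - exact: stable_nilpotent.
  - move=> T2 T3 u a y na ny; rewrite rmorphB rmorph1 -psi_nat ?rmorph0 //.
    exact: nilpotent0.
  - move=> T2 a y na ny; rewrite mulrBr mulr1.
    have := phiE T2 0 y (nilpotent0 _) ny; rewrite /phi !of_coord0 !add0r.
    by rewrite (Defs.coord0 coord_x) add0r of_coordK // => <-; rewrite subrr.
  - exact: nilpotent0.
exists (chi T (x h) (x g)).
have ng := coord_nilpotent g; have nh := coord_nilpotent h.
have -> : 1 + x g * chi T (x h) (x g) = psi T (x g) (x h).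
  by rewrite (psiE T (x h) (x g) nh ng) psi0.
have := phiE T (x g) (x h) ng nh; rewrite /phi !coordK => ->.
by rewrite of_coord0 addr0.
Qed.

(** Apply [coordD] to g = h + (g - h) and invert 1 + x(h) e, where x(h) e is nilpotent. *)
Lemma coordB T (g h : G T) : exists v, v * (x g - x h) = x (g - h).
Proof.
have [e] := coordD h (g - h); rewrite addrC subrK => xg.
have [v v1] : exists v, v * (1 + x h * e) = 1.
  by apply: nilpotent_unit; rewrite mulrC; apply/nilpotentMl/coord_nilpotent.
by exists v; rewrite xg addrC addKr mulrCA v1 mulr1.
Qed.

Lemma coordMn T (g : G T) n : exists e, x (g *+ n) = x g * (n%:R + x g * e).
Proof.
elim: n => [|n [e IH]].
  by exists 0; rewrite mulr0n (Defs.coord0 coord_x) mulr0 addr0 mulr0.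
have [e' xD] := coordD g (g *+ n); rewrite mulrS xD IH.
exists (e + e' * (n%:R + x g * e)).
by rewrite -natr1; ring.
Qed.

End FormalGroups.

(** * Expansions over R and the series of multiplication by p *)

Section FormalGroups.
Variable R : comUnitRingType.
Hypothesis complete_R : complete_local_ring R.
Variable G : formal_group R.
Implicit Types T : tring R.

(** Expand over each T separately; by uniqueness the coefficients are compatible, so they come from
    R by [global_function]. *)
Lemma expansion_global n D (P : nat -> {poly R}) (phi : forall T, T -> T) :
  distinguished n.+1 D -> graded n.+1 P ->
  (forall T T' (u : thom T T') (y : T), pev y D = 0 ->
    phi T' (u y) = u (phi T y)) ->
  exists r : 'I_n.+1 -> R, forall T (y : T), pev y D = 0 ->
    phi T y = \sum_(j < n.+1) tstr T (r j) * pev y (P j).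
Proof.
move=> dD gP phi_nat.
pose E T := @expansion R T n D P (fun T' _ y => phi T' y) dD gP
  (fun T' T'' v _ y => phi_nat T' T'' v y).
pose c T : {ffun 'I_n.+1 -> T} := sval (cid (E T)).
have cE T T' (u : thom T T') (y : T') : pev y D = 0 ->
    phi T' y = \sum_(j < n.+1) u (c T j) * pev y (P j).
  by rewrite /c; case: (cid (E T)) => d [dE _] /=; apply: dE.
have c_uniq T (d : {ffun 'I_n.+1 -> T}) :
    (forall T' (u : thom T T') (y : T'), pev y D = 0 ->
      phi T' y = \sum_(j < n.+1) u (d j) * pev y (P j)) -> c T = d.
  by rewrite /c; case: (cid (E T)) => d' [_ d'_uniq] /= /d'_uniq.
have c_nat T T' (u : thom T T') j : c T' j = u (c T j).
  have -> : c T' = [ffun i => u (c T i)]; last by rewrite ffunE.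
  apply: c_uniq => T'' v y Dy; rewrite (cE T T'' (thom_comp v u)) //.
  by apply: eq_bigr => i _; rewrite ffunE.
have /choice[r rE] : forall j, exists r, forall T, c T j = tstr T r.
  move=> j; apply: (global_function complete_R G) => T T' u; exact: c_nat.
exists r => T y Dy; rewrite (cE T T (thom_id T)) //.
by apply: eq_bigr => j _; rewrite /= rE.
Qed.

Lemma expansion_eq0 n D (P : nat -> {poly R}) (r : 'I_n.+1 -> R) :
  distinguished n.+1 D -> graded n.+1 P ->
  (forall T (y : T), pev y D = 0 ->
    \sum_(j < n.+1) tstr T (r j) * pev y (P j) = 0) ->
  forall j, r j = 0.
Proof.
move=> dD gP r0 j; apply: (tstr_eq0 complete_R) => T.
have [|c [cE c_uniq]] := @expansion R T n D P (fun _ _ _ => 0) dD gP.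
  by move=> T' T'' v u y _; rewrite rmorph0.
have <- : c j = tstr T (r j).
  rewrite (c_uniq [ffun i => tstr T (r i)]) ?ffunE // => T' u y Dy.
  by rewrite -[LHS](r0 _ _ Dy); apply: eq_bigr => i _; rewrite ffunE tmor_str.
rewrite (c_uniq [ffun=> 0]) ?ffunE // => T' u y Dy.
by rewrite big1 // => i _; rewrite ffunE rmorph0 mul0r.
Qed.

Lemma graded_Xn n : graded n (fun i => 'X^i : {poly R}).
Proof. by move=> i _; rewrite monicXn size_polyXn. Qed.

Variables (x : forall T, G T -> T).
Hypothesis coord_x : coordinate x.
Let coord_nil := coord_nilpotent coord_x.
Local Notation of_coord := (of_coord x).

Lemma natural_mulrn n T T' (u : thom T T') (y : T) : nilpotent_elt y ->
  x (of_coord (u y) *+ n) = u (x (of_coord y *+ n)).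
Proof.
by move=> ny; rewrite -(amap_of_coord coord_x) // -raddfMn (coord_nat coord_x).
Qed.

Lemma multiplication_series p : exists F : series R,
  [/\ forall T (g : G T), x (g *+ p) = sev (x g) F, F 0%N = 0 & F 1%N = p%:R].
Proof.
have mulp_nat T : natural_on (fun T' => @nilpotent_elt T')
    (fun T' (_ : thom T T') (y : T') => x (of_coord y *+ p)).
  by move=> T' T'' v _ y; apply: natural_mulrn.
pose c T := sval (cid (power_series (mulp_nat T))).
have cE T T' (u : thom T T') (y : T') k : y ^+ k = 0 ->
    x (of_coord y *+ p) = \sum_(i < k) u (c T i) * y ^+ i.
  rewrite /c; case: (cid (power_series (mulp_nat T))) => d [dE _] /=.
  exact: dE.
have c_uniq T (d : nat -> T) :
    (forall T' (u : thom T T') (y : T') k, y ^+ k = 0 ->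
      x (of_coord y *+ p) = \sum_(i < k) u (d i) * y ^+ i) -> c T = d.
  rewrite /c; case: (cid (power_series (mulp_nat T))) => d' [_ d'_uniq] /=.
  exact: d'_uniq.
have c_nat T T' (u : thom T T') j : c T' j = u (c T j).
  have -> // : c T' = fun i => u (c T i).
  apply: c_uniq => T'' v y k yk; exact: (cE T T'' (thom_comp v u)).
have /choice[F FE] : forall j, exists r, forall T, c T j = tstr T r.
  move=> j; apply: (global_function complete_R G) => T T' u; exact: c_nat.
have xE T (g : G T) : x (g *+ p) = sev (x g) F.
  have [k yk] := coord_nil g; rewrite -{1}[g](coordK coord_x).
  rewrite /sev (psumE _ yk) (cE T T (thom_id T) _ _ yk).
  by apply: eq_bigr => i _; rewrite FE.
(* These are the first two coefficients of F - p X. They vanish because [coordMn] gives x([p] g) = p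
   x(g) on {X^2 = 0}. *)
pose d (i : 'I_2) : R := if i is Ordinal 0 _ then F 0%N else F 1%N - p%:R.
have d0 : forall j, d j = 0.
  apply: (@expansion_eq0 1 _ (fun i => 'X^i) d
    (distinguished_XnM 1 (distinguishedX R))).
    exact: graded_Xn.
  move=> T y; rewrite pev_XnM /pev evX expr1 => y2.
  have ny : nilpotent_elt y by exists 2%N; rewrite expr2.
  rewrite !big_ord_recl big_ord0 /= !evXn mulr1 expr1 addr0.
  have [e] := coordMn coord_x (of_coord y) p.
  rewrite xE of_coordK // mulrDr mulrA y2 mul0r addr0.
  rewrite /sev (@psumE _ _ _ 2) ?expr2 // !big_ord_recl big_ord0 /= mulr1 expr1.
  rewrite addr0 rmorphB rmorph_nat mulrBl addrA => ->.
  by rewrite mulrC subrr.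
exists F; split=> //; first exact: (d0 ord0).
by apply/eqP; rewrite -subr_eq0 -[_ - _]/(d (lift ord0 ord0)) d0.
Qed.

(** If no coefficient of F were a unit, F would vanish on the special fibre and every power of
    Frobenius would divide it. The first unit coefficient is not that of X, which is p, so V has
    positive degree m + 1. *)
Lemma weierstrass_multiplication p h : maxideal (p%:R : R) ->
  ~ frobenius_divides p x h ->
  exists m (V : {poly R}) (a b : series R),
  [/\ distinguished m.+1 V, a * b = 1, V`_0 * b 0%N = p%:R &
    forall T (g : G T), x (g *+ p) = x g * pev (x g) V * sev (x g) b].
Proof.
move=> mp nfrob; have [F [FE F0 F1]] := multiplication_series p.
have ex_unit : exists i, F i.+1 \is a GRing.unit.
  apply: contrapT => nunit; apply: nfrob; exists (fun=> 0) => T kerT g n gn.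
  rewrite FE /sev (psumE _ gn) !big1 // => i _; first by rewrite rmorph0 mul0r.
  rewrite kerT ?mul0r //; case: (nat_of_ord i) => [|j].
    by rewrite F0; apply: maxideal0.
  by apply/negP => uj; apply: nunit; exists j.
have [n un n_min] := find_ex_minn ex_unit.
case: n un n_min => [|m] un n_min.
  by move: mp; rewrite /maxideal /= -F1 un.
pose V1 := series_shift 1 F.
have [V [a [b [dV ab VE]]]] : exists V a b,
    [/\ distinguished m.+1 V, a * b = 1 & series_poly V = a * V1].
  apply: (weierstrass_preparation complete_R) => [i lt_i|]; last exact: un.
  by apply/negP => /n_min; rewrite leqNgt lt_i.
have V1E : V1 = series_poly V * b by rewrite VE mulrAC ab mul1r.
exists m, V, a, b; split => //.
  rewrite -F1 -[F 1%N]/(V1 0%N) V1E series_mulfE big_ord1 //.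
move=> T g; rewrite FE /sev psumS // F0 rmorph0 add0r -mulrA; congr (_ * _).
rewrite -sev_poly // -sevM // -V1E //.
Qed.

End FormalGroups.

(** * Newton interpolation along the multiples of a point *)

Section Newton.
Variable R : comUnitRingType.
Hypothesis complete_R : complete_local_ring R.
Variables (G : formal_group R) (x : forall T, G T -> T).
Hypothesis coord_x : coordinate x.
Implicit Types T : tring R.
Let coord_nil := coord_nilpotent coord_x.
Local Notation of_coord := (of_coord x).

Variables (p m : nat) (V : {poly R}) (a b : series R).
Hypothesis p_regular : GRing.lreg (p%:R : R).
Hypothesis p_units : forall j, (0 < j < p)%N -> (j%:R : R) \is a GRing.unit.
Hypothesis dV : distinguished m.+1 V.
Hypothesis Vb : V`_0 * b 0%N = p%:R.
Hypothesis mulpE : forall T (g : G T),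
  x (g *+ p) = x g * pev (x g) V * sev (x g) b.

Let nilV T (y : T) : pev y V = 0 -> nilpotent_elt y := distinguished_root dV.

(** O({V = 0}) is free over R, so p can be cancelled coefficient by coefficient. *)
Lemma p_regular_on_root (rho : forall T, T -> T) :
  (forall T T' (u : thom T T') (y : T), pev y V = 0 ->
    rho T' (u y) = u (rho T y)) ->
  (forall T (y : T), pev y V = 0 -> p%:R * rho T y = 0) ->
  forall T (y : T), pev y V = 0 -> rho T y = 0.
Proof.
move=> rho_nat rho0 T y Vy.
have [r rE] := expansion_global complete_R G dV (@graded_Xn R m.+1) rho_nat.
have r0 j : r j = 0.
  apply: p_regular; rewrite mulr0; move: j.
  apply: (expansion_eq0 complete_R (r := fun j => p%:R * r j) dV
    (@graded_Xn R m.+1)).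
  move=> T' y' Vy'; rewrite -[RHS](rho0 T' y' Vy') rE // mulr_sumr.
  by apply: eq_bigr => j _; rewrite rmorphM rmorph_nat mulrA.
by rewrite rE // big1 // => j _; rewrite r0 rmorph0 mul0r.
Qed.

(** Writing V = X q + V(0), a root satisfies y q(y) = - V(0), and V(0) divides p. *)
Lemma root_dvd_p T (y : T) : pev y V = 0 -> exists c, c * y = p%:R.
Proof.
move=> Vy; pose q := \poly_(i < size V) V`_i.+1.
have VE : V = q * 'X + (V`_0)%:P.
  apply/polyP => i; rewrite coefD coefMX coefC coef_poly.
  case: i => [|i] /=; first by rewrite add0r.
  by rewrite addr0; case: ltnP => // le_i; rewrite nth_default // ltnW.
move: Vy; rewrite /pev VE rmorphD rmorphM /= evX evC => /eqP.
rewrite addrC addr_eq0 => /eqP V0.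
exists (- tstr T (b 0%N) * ev (tstr T) y q).
by rewrite -mulrA mulNr -mulrN -V0 -rmorphM mulrC Vb rmorph_nat.
Qed.

Lemma root_regular (rho : forall T, T -> T) :
  (forall T T' (u : thom T T') (y : T), pev y V = 0 ->
    rho T' (u y) = u (rho T y)) ->
  (forall T (y : T), pev y V = 0 -> y * rho T y = 0) ->
  forall T (y : T), pev y V = 0 -> rho T y = 0.
Proof.
move=> rho_nat rho0; apply: p_regular_on_root => // T y Vy.
by have [c <-] := root_dvd_p Vy; rewrite -mulrA rho0 // mulr0.
Qed.

(** By [coordB] the difference divides x([j - i] g), which is (j - i) x(g) up to a multiple of
    x(g)^2, hence a unit times x(g), as j - i is invertible. *)
Lemma multiples_separated T (g : G T) i j : (i < j < p)%N ->
  exists w, w * (x (g *+ j) - x (g *+ i)) = x g.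
Proof.
move=> /andP[lt_ij lt_jp]; have [v vE] := coordB coord_x (g *+ j) (g *+ i).
have [e eE] := coordMn coord_x g (j - i).
have uji : ((j - i)%:R : R) \is a GRing.unit.
  by apply: p_units; rewrite subn_gt0 lt_ij (leq_ltn_trans (leq_subr _ _)).
pose s := tstr T ((j - i)%:R^-1).
have sji : s * (j - i)%:R = 1.
  by rewrite -(rmorph_nat (tstr T)) -rmorphM mulVr ?rmorph1.
have [w w1] : exists w, w * (1 + s * e * x g) = 1.
  by apply: nilpotent_unit; apply/nilpotentMl/coord_nil.
exists (w * s * v); rewrite -mulrA vE -mulrnBr ?(ltnW lt_ij) // eE.
transitivity (w * (s * (j - i)%:R + s * e * x g) * x g); first by ring.
by rewrite sji w1 mul1r.
Qed.

Lemma root_torsion T (y : T) : pev y V = 0 -> of_coord y *+ p = 0.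
Proof.
move=> Vy; apply: (coord_inj coord_x).
rewrite mulpE (of_coordK coord_x (nilV Vy)).
by rewrite Vy mulr0 mul0r (Defs.coord0 coord_x).
Qed.

Let multiple i T (y : T) := x (of_coord y *+ i).

Let multiple_nat i T T' (u : thom T T') (y : T) : pev y V = 0 ->
  multiple i (u y) = u (multiple i y).
Proof. by move=> /nilV; apply: natural_mulrn. Qed.

Lemma multiples_regular j k (rho : forall T, T -> T) : (k <= j < p)%N ->
  (forall T T' (u : thom T T') (y : T), pev y V = 0 ->
    rho T' (u y) = u (rho T y)) ->
  (forall T (y : T), pev y V = 0 ->
    (\prod_(i < k) (multiple j y - multiple i y)) * rho T y = 0) ->
  forall T (y : T), pev y V = 0 -> rho T y = 0.
Proof.
move=> /andP[le_kj lt_jp] rho_nat; elim: k le_kj => [|k IH] lt_kj rho0.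
  by move=> T y Vy; rewrite -[RHS](rho0 T y Vy) big_ord0 mul1r.
apply: IH (ltnW lt_kj) _; apply: root_regular => [T T' u y Vy|T y Vy].
  rewrite rmorphM rmorph_prod rho_nat //; congr (_ * _); apply: eq_bigr => i _.
  by rewrite rmorphB !multiple_nat.
have lt_kjp : (k < j < p)%N by rewrite lt_kj.
have [w] := multiples_separated (of_coord y) lt_kjp.
rewrite (of_coordK coord_x (nilV Vy)) -/(multiple j y) -/(multiple k y) => wE.
have := rho0 T y Vy; rewrite big_ord_recr /= => e.
rewrite -{1}wE; transitivity (w * 0); last exact: mulr0.
rewrite -e; ring.
Qed.

(** Induction on j. At t = x([j] y) the left side vanishes, as y is p-torsion, and the product of
    the previous factors is regular by [multiples_regular]; hence Q vanishes there, and [hadamard]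
    around this point extracts the next factor. *)
Lemma newton_division j : (j <= p)%N -> exists Q : forall T, T -> T -> T,
  natural_in (fun T y => pev y V = 0) Q /\
  forall T (y t : T), pev y V = 0 -> nilpotent_elt t ->
    x (of_coord t *+ p) = (\prod_(i < j) (t - multiple i y)) * Q T y t.
Proof.
have V_stable : stable (fun T y => pev (T := T) y V = 0).
  by move=> T T' u y Vy; rewrite -tmor_pev Vy rmorph0.
elim: j => [_|j IH lt_jp].
  exists (fun T _ t => x (of_coord t *+ p)); split.
    by move=> T T' u y t _ nt; apply: natural_mulrn.
  by move=> T y t _ _; rewrite big_ord0 mul1r.
have [Q [Q_nat QE]] := IH (ltnW lt_jp).
have Q0 T (y : T) : pev y V = 0 -> Q T y (multiple j y) = 0.
  apply: (@multiples_regular j j (fun T y => Q T y (multiple j y))).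
  - by rewrite leqnn.
  - by move=> T1 T2 u z Vz; rewrite multiple_nat // Q_nat //; apply: coord_nil.
  move=> T1 z Vz; rewrite -QE // /multiple; last exact: coord_nil.
  rewrite coordK // -mulrnA mulnC mulrnA root_torsion // mul0rn.
  by rewrite (Defs.coord0 coord_x).
pose phi T (y t : T) := Q T y (multiple j y + t).
have phi_nat : natural_in (fun T y => pev y V = 0) phi.
  move=> T T' u y t Vy nt; rewrite /phi multiple_nat // -rmorphD Q_nat //.
  by apply: nilpotentD => //; apply: coord_nil.
have [psi [psi_nat phiE]] := hadamard V_stable phi_nat.
exists (fun T y t => psi T y (t - multiple j y)); split.
  move=> T T' u y t Vy nt; rewrite multiple_nat // -rmorphB psi_nat //.
  by apply/nilpotentD/nilpotentN/coord_nil.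
move=> T y t Vy nt; rewrite (QE T y t Vy nt) big_ord_recr -mulrA /=.
congr (_ * _); have := phiE T y (t - multiple j y) Vy.
rewrite /phi addr0 Q0 // [multiple j y + _]addrC subrK.
by rewrite add0r => -> //; apply/nilpotentD/nilpotentN/coord_nil.
Qed.

Lemma level_equation T (y : T) (g : G T) : pev y V = 0 ->
  \prod_(i < p) (x g - x (of_coord y *+ i)) = 0 -> g *+ p = 0.
Proof.
move=> Vy prod0; apply: (coord_inj coord_x).
have [Q [_ QE]] := newton_division (leqnn p).
rewrite -{1}[g](coordK coord_x) (QE T y) // prod0 mul0r.
by rewrite (Defs.coord0 coord_x).
Qed.

End Newton.

(** * The p-torsion is a divisor *)

Section FunctionsOnFormalLine.
Variable R : comUnitRingType.
Implicit Types (T : tring R) (W : {poly R}).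

(** If phi = sum c_i X^i, then phi W = sum c_i X^i W is already an expansion in [wbasis], so
    uniqueness of Weierstrass division of 0 kills every c_i. *)
Lemma distinguished_regular T N W (phi : forall T', thom T T' -> T' -> T') :
  distinguished N.+1 W -> natural_on (fun T' => @nilpotent_elt T') phi ->
  (forall T' (u : thom T T') (y : T'), nilpotent_elt y ->
    phi T' u y * pev y W = 0) ->
  forall T' (u : thom T T') (y : T'), nilpotent_elt y -> phi T' u y = 0.
Proof.
move=> dW phi_nat phi0 T' u y [k yk].
have [c [cE _]] := power_series phi_nat.
have [|e [_ e_uniq]] := @weierstrass_division R T N W (fun _ _ _ => 0) dW.
  by move=> T1 T2 v w z _; rewrite rmorph0.
have e0 : e = fun=> 0.
  apply: e_uniq => T1 v z l _.
  by rewrite big1 // => i _; rewrite rmorph0 mul0r.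
have ec : e = fun i => if (i < N.+1)%N then 0 else c (i - N.+1)%N.
  apply: e_uniq => T1 v z l zl.
  rewrite big_split_ord /= big1 ?add0r => [|i _]; last first.
    by rewrite ltn_ord rmorph0 mul0r.
  have [K zK] : nilpotent_elt z.
    by apply: (distinguished_root (distinguished_XnM l dW)); rewrite pev_XnM.
  (* With l + K terms the series for phi is exact; those of index at least l, times W, vanish
     because z^l W(z) = 0. *)
  have zKl : z ^+ (l + K) = 0 by rewrite exprD zK mulr0.
  have := phi0 T1 v z (ex_intro _ _ zK); rewrite (cE _ _ _ _ zKl).
  rewrite big_split_ord mulrDl [X in _ + X]mulr_suml /=.
  rewrite [X in _ + X]big1 => [|i _]; last first.
    rewrite exprD; transitivity (v (c (l + i)%N) * z ^+ i * (z ^+ l * pev z W)).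
      by ring.
    by rewrite zl mulr0.
  rewrite addr0 mulr_suml => e1; rewrite -[LHS]e1; apply: eq_bigr => i _.
  by rewrite ltnNge leq_addr addKn wbasis_high mulrA.
rewrite (cE _ _ _ _ yk) big1 // => i _.
have := congr1 (fun d => d (N.+1 + i)%N) ec.
rewrite e0 ltnNge leq_addr addKn /= => <-.
by rewrite rmorph0 mul0r.
Qed.

(** The remainder of Weierstrass division vanishes on {W = 0}, so its coefficients in 1, ..., X^N
    are 0 by [expansion]. *)
Lemma weierstrass_quotient T N W (phi : forall T', thom T T' -> T' -> T') :
  distinguished N.+1 W -> natural_on (fun T' => @nilpotent_elt T') phi ->
  (forall T' (u : thom T T') (y : T'), pev y W = 0 -> phi T' u y = 0) ->
  exists c : nat -> T, forall T' (u : thom T T') (y : T'), nilpotent_elt y ->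
    phi T' u y = psum (fun i => u (c i)) y * pev y W.
Proof.
move=> dW phi_nat phi0.
have [c [cE _]] := weierstrass_division dW phi_nat.
have [|e [_ e_uniq]] := @expansion R T N W (fun i => 'X^i) (fun _ _ _ => 0)
    dW (@graded_Xn R N.+1).
  by move=> T1 T2 v w z _; rewrite rmorph0.
have e0 : e = [ffun=> 0].
  apply: e_uniq => T1 v z _.
  by rewrite big1 // => i _; rewrite ffunE rmorph0 mul0r.
have ec : e = [ffun i : 'I_N.+1 => c i].
  apply: e_uniq => T1 v z Wz; rewrite -[LHS](phi0 T1 v z Wz).
  rewrite (cE _ _ _ 0%N) ?Wz ?mulr0 // addn0; apply: eq_bigr => i _.
  by rewrite ffunE wbasis_low ?ltn_ord // /pev evXn.
exists (fun i => c (N.+1 + i)%N) => T' u y [k yk].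
rewrite (psumE _ yk) mulr_suml (cE _ _ _ k) ?yk ?mul0r // big_split_ord /=.
rewrite big1 ?add0r => [|i _].
  by apply: eq_bigr => i _; rewrite wbasis_high mulrA.
have := congr1 (fun d : {ffun 'I_N.+1 -> T} => d i) ec.
by rewrite e0 !ffunE => <-; rewrite rmorph0 mul0r.
Qed.

End FunctionsOnFormalLine.

Section TorsionDivisor.
Variable R : comUnitRingType.
Variables (G : formal_group R) (x : forall T, G T -> T).
Hypothesis coord_x : coordinate x.
Implicit Types T : tring R.
Let coord_nil := coord_nilpotent coord_x.
Local Notation of_coord := (of_coord x).

Variables (p m : nat) (W : {poly R}) (a b : series R).
Hypothesis dW : distinguished m.+1 W.
Hypothesis ab : a * b = 1.
Hypothesis mulpE : forall T (g : G T), x (g *+ p) = pev (x g) W * sev (x g) b.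

Lemma sev_inverse T (y : T) : nilpotent_elt y -> sev y b * sev y a = 1.
Proof. by move=> ny; rewrite -sevM // mulrC ab sev1. Qed.

Lemma pev_multiplication T (g : G T) : pev (x g) W = x (g *+ p) * sev (x g) a.
Proof. by rewrite mulpE -mulrA sev_inverse ?mulr1. Qed.

Lemma torsionP T (g : G T) : g *+ p = 0 <-> pev (x g) W = 0.
Proof.
split=> [g0|W0].
  by rewrite pev_multiplication g0 (Defs.coord0 coord_x) mul0r.
by apply: (coord_inj coord_x); rewrite mulpE W0 mul0r (Defs.coord0 coord_x).
Qed.

Variable T : tring R.
Local Notation D := (torsion (G := G) (T := T) p).

Lemma multiplication_nat (U : subobj (base_change G T)) T' T'' (v : thom T' T'')
    (z : base_change G T T') (zU : U T' z) (vzU : U T'' (fmap v z)) :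
  x ((fmap v z).2 *+ p) = v (x (z.2 *+ p)).
Proof. by rewrite -(coord_nat coord_x) raddfMn. Qed.

Definition multiplication_fun (U : subobj (base_change G T)) : ofun U :=
  @OFun R _ U (fun T' z _ => x (z.2 *+ p)) (@multiplication_nat U).

Lemma torsion_closed : closed_subscheme D.
Proof.
move=> T' z; split=> [Dz|[Uz zD]]; first by exists I => f; apply.
apply: (coord_inj coord_x); rewrite (Defs.coord0 coord_x).
apply: (zD (multiplication_fun (whole _))) => T1 z1 _ z1D /=.
by rewrite z1D (Defs.coord0 coord_x).
Qed.

(** The ideal has a global generator, so Spec T is covered by the single basic open set D(1). *)
Let U := basic_open (G := G) (1 : T).

Let in_U T' (z : base_change G T T') : U z.
Proof. by exists 1; rewrite rmorph1 mulr1. Qed.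

Let on_line (h : ofun U) T' (u : thom T T') (y : T') : T' :=
  h T' (u, of_coord y) (in_U (u, of_coord y)).

Let ofun_eq (h : ofun U) T' (z z' : base_change G T T')
    (Uz : U z) (Uz' : U z') :
  z = z' -> h T' z Uz = h T' z' Uz'.
Proof.
by move=> e; case: _ / e Uz' => Uz'; rewrite (Prop_irrelevance Uz Uz').
Qed.

Let on_lineE (h : ofun U) T' (z : base_change G T T') (Uz : U z) :
  h T' z Uz = on_line h z.1 (x z.2).
Proof. by apply: ofun_eq; rewrite coordK //; case: z {Uz}. Qed.

Let on_line_nat (h : ofun U) :
  natural_on (fun T' => @nilpotent_elt T') (on_line h).
Proof.
move=> T' T'' v u y ny.
pose z : base_change G T T' := (u, of_coord y).
rewrite -(@oev_nat _ _ _ h _ _ v z (in_U z) (in_U (fmap v z))).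
by apply: ofun_eq; rewrite /= /bc_map /= amap_of_coord.
Qed.

(** The generator x([p] g) is W times the unit given by [b], with inverse given by [a], so both
    conditions reduce to statements about W. *)
Lemma torsion_invertible : invertible_ideal D.
Proof.
exists 1%N, (fun=> 1), (fun=> 1); split=> [|_]; first by rewrite big_ord1 mulr1.
exists (multiplication_fun U); split.
  move=> h h0 T' z Uz; rewrite on_lineE.
  apply: (distinguished_regular dW (@on_line_nat h)) => // T1 u y ny.
  have := h0 T1 (u, of_coord y) (in_U _).
  rewrite /= -/(on_line h u y) mulpE of_coordK //.
  move=> /(congr1 (fun t => t * sev y a)).
  by rewrite mul0r -!mulrA sev_inverse ?mulr1.
move=> h; split=> [hD|[c hE] T' z Uz Dz]; last first.
  by rewrite hE /= Dz (Defs.coord0 coord_x) mulr0.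
have [|c cE] := weierstrass_quotient dW (@on_line_nat h).
  move=> T' u y Wy; apply: hD => /=; apply/torsionP.
  by rewrite of_coordK //; apply: distinguished_root dW Wy.
pose q T' (z : base_change G T T') (_ : U z) : T' :=
  psum (fun i => z.1 (c i)) (x z.2) * sev (x z.2) a.
have q_nat T' T'' (v : thom T' T'') z (Uz : U z) (Uvz : U (fmap v z)) :
    q T'' (fmap v z) Uvz = v (q T' z Uz).
  by rewrite rmorphM rmorph_psum // tmor_sev // /q /= (coord_nat coord_x).
exists (OFun q_nat) => T' z Uz.
by rewrite on_lineE cE //= /q -mulrA [sev _ _ * _]mulrC -pev_multiplication.
Qed.

Lemma torsion_finite_free : finite_free D.
Proof.
have [B [i [s [[Ws univ] basis]]]] := universal_rootP T dW.
have ns : nilpotent_elt s := distinguished_root dW Ws.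
have {}basis := basis _ (@graded_Xn R m.+1).
exists B, (i, of_coord s); split; last split.
- by apply/torsionP; rewrite of_coordK.
- move=> T' [u g] /= /torsionP Wg; have [v [vi vs]] := univ T' u (x g) Wg.
  exists v; split=> [|w]; rewrite /bc_map /= amap_of_coord //.
    by rewrite vi vs coordK.
  (* Uniqueness holds because the powers of [s] span [B] over [T]. *)
  move=> [wi ws]; apply: thom_eq => t; have [c [-> _]] := basis t.
  have wvs : w s = v s.
    by rewrite vs -ws of_coordK //; apply: nilpotent_rmorph.
  rewrite !rmorph_sum; apply: eq_bigr => j _; rewrite !rmorphM !tmor_pev wvs.
  by congr (_ * _); rewrite (thom_compE _ vi) (thom_compE _ wi).
- by exists m.+1, (fun j => pev s 'X^j).
Qed.

Lemma torsion_divisor : divisor D.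
Proof.
split; [exact: torsion_closed | exact: torsion_invertible |].
exact: torsion_finite_free.
Qed.

End TorsionDivisor.

(** * Homomorphisms from Z/p *)

Section CyclicHoms.
Variables (p : nat) (M : zmodType).
Hypothesis p_gt1 : (1 < p)%N.

Lemma Zp_mulrn_char (a : 'Z_p) : a *+ p = 0.
Proof. by rewrite -mulr_natr pchar_Zp // mulr0. Qed.

Lemma Zp_hom_mulrn (l : {additive 'Z_p -> M}) (a : 'Z_p) : l a = l 1 *+ a.
Proof. by rewrite -raddfMn natr_Zp. Qed.

Lemma Zp_hom_torsion (l : {additive 'Z_p -> M}) : l 1 *+ p = 0.
Proof. by rewrite -raddfMn Zp_mulrn_char raddf0. Qed.

Lemma Zp_hom_eq (l l' : {additive 'Z_p -> M}) : l 1 = l' 1 -> l = l'.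
Proof.
by move=> e; apply: additive_eq => a; rewrite Zp_hom_mulrn e -Zp_hom_mulrn.
Qed.

Lemma Zp_hom_exists (g : M) :
  g *+ p = 0 -> exists l : {additive 'Z_p -> M}, l 1 = g.
Proof.
move=> g0; pose f (a : 'Z_p) := g *+ a.
have modp n : g *+ (n %% (Zp_trunc p).+2) = g *+ n.
  rewrite Zp_cast // [in RHS](divn_eq n p) mulrnDr mulnC mulrnA g0.
  by rewrite mul0rn add0r.
have fD : nmod_morphism f.
  split=> [|a b]; first by rewrite /f mulr0n.
  by rewrite /f /= -mulrnDr modp.
pose fa := GRing.isNmodMorphism.Build _ _ f fD.
pose F : {additive 'Z_p -> M} := HB.pack f fa.
by exists F; apply: (modp 1%N).
Qed.

End CyclicHoms.

Lemma ofun_ext (R : comUnitRingType) (X : functor R) (f f' : ofun (whole X)) :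
  (forall T (z : X T), f T z I = f' T z I) -> f = f'.
Proof.
case: f f' => [f f_nat] [f' f'_nat] /= ff'.
have e : f = f'.
  apply: functional_extensionality_dep => T.
  apply: functional_extensionality_dep => z.
  by apply: functional_extensionality_dep => -[].
by case: _ / e f'_nat {ff'} => f'_nat; rewrite (Prop_irrelevance f_nat f'_nat).
Qed.

(** * Roots of V are level structures, and injectivity *)

Section Main.
Variable R : comUnitRingType.
Hypothesis complete_R : complete_local_ring R.
Variables (G : formal_group R) (x : forall T, G T -> T).
Hypothesis coord_x : coordinate x.
Implicit Types T : tring R.
Let coord_nil := coord_nilpotent coord_x.
Local Notation of_coord := (of_coord x).

Variables (p m : nat) (V : {poly R}) (a b : series R).
Hypothesis p_prime : prime p.
Hypothesis p_regular : GRing.lreg (p%:R : R).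
Hypothesis p_units : forall j, (0 < j < p)%N -> (j%:R : R) \is a GRing.unit.
Hypothesis dV : distinguished m.+1 V.
Hypothesis ab : a * b = 1.
Hypothesis Vb : V`_0 * b 0%N = p%:R.
Hypothesis mulpE : forall T (g : G T),
  x (g *+ p) = x g * pev (x g) V * sev (x g) b.

Let W := 'X^1 * V.

Let dW : distinguished m.+2 W.
Proof. by rewrite -[m.+2]addn1; apply: distinguished_XnM. Qed.

Let WE T (y : T) : pev y W = y * pev y V.
Proof. by rewrite pev_XnM expr1. Qed.

Let mulpW T (g : G T) : x (g *+ p) = pev (x g) W * sev (x g) b.
Proof. by rewrite mulpE WE. Qed.

Let p_gt1 : (1 < p)%N := prime_gt1 p_prime.

(** The product [pr] of the functions x - x(l z) lies in the ideal of the divisor sum, so it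
    vanishes at the given point; [level_equation] then shows that the point is p-torsion. *)
Lemma root_level T (l : hom_scheme G 'Z_p T) :
  pev (x (l 1)) V = 0 -> level G 'Z_p T l.
Proof.
move=> Vl q q_prime; rewrite card_ord Zp_cast // dvdn_prime2 // => /eqP ->.
split; first exact: (torsion_divisor coord_x dW ab mulpW).
move=> T' [u g] [ug Hg]; rewrite /torsion /=.
pose X := base_change G T.
have lin_nat (z : 'Z_p) T1 T2 (v : thom T1 T2) (w : X T1)
    (_ : whole X T1 w) (_ : whole X T2 (fmap v w)) :
    x (fmap v w).2 - (fmap v w).1 (x (l z)) = v (x w.2 - w.1 (x (l z))).
  by rewrite rmorphB; congr (_ - _); apply: (coord_nat coord_x).
pose lin (z : 'Z_p) : ofun (whole X) := OFun (lin_nat z).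
pose one : ofun (whole X) := @OFun R X (whole X) (fun T1 _ _ => 1)
  (fun T1 T2 v _ _ _ => esym (rmorph1 v)).
have pr_nat T1 T2 (v : thom T1 T2) (w : X T1)
    (zw : whole X T1 w) (zvw : whole X T2 (fmap v w)) :
    \prod_(z : 'Z_p | z *+ p == 0) lin z T2 (fmap v w) zvw =
    v (\prod_(z : 'Z_p | z *+ p == 0) lin z T1 w zw).
  by rewrite rmorph_prod; apply: eq_bigr => z _; apply: oev_nat.
pose pr : ofun (whole X) := OFun pr_nat.
have pr0 : pr T' (u, g) ug = 0.
  apply: Hg.
  exists 1%N, (fun=> one), (fun=> lin); split=> [_ z _ T1 [w h] wh|T1 w Iw].
    by rewrite /section_divisor /= => ->; rewrite (coord_nat coord_x) subrr.
  by rewrite big_ord1 /= mul1r.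
pose y := u (x (l 1)).
have Vy : pev y V = 0 by rewrite -tmor_pev Vl rmorph0.
apply: (level_equation complete_R coord_x p_regular p_units dV Vb mulpE Vy).
(* All of Z/p is killed by p, so the filtered product runs over all i < p. *)
rewrite -[RHS]pr0 /= -(big_mkord xpredT (fun i => x g - x (of_coord y *+ i))).
rewrite -{1}(Zp_cast p_gt1) big_mkord; apply: eq_big => [z|z _].
  by rewrite Zp_mulrn_char ?eqxx.
rewrite -!(coord_nat coord_x) (Zp_hom_mulrn l z) raddfMn /y.
by rewrite -(coord_nat coord_x) coordK.
Qed.

Lemma hom_function_eq0 (f : forall T, hom_scheme G 'Z_p T -> T) :
  (forall T T' (u : thom T T') l, f T' (fmap u l) = u (f T l)) ->
  (forall T, f T (zero_hom G 'Z_p T) = 0) ->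
  (forall T l, level G 'Z_p T l -> f T l = 0) ->
  forall T l, f T l = 0.
Proof.
move=> f_nat f_zero f_level.
pose hom T := hom_scheme G 'Z_p T.
(* [f] as a function of the coordinate y = x(l(1)), which determines l; the default 0 is taken when
   y is not of this form. *)
pose phi T (y : T) : T :=
  if pselect (exists l : hom T, x (l 1) = y) is left e
  then f T (sval (cid e)) else 0.
have phiE T (l : hom T) : phi T (x (l 1)) = f T l.
  rewrite /phi; case: pselect => [e|[]]; last by exists l.
  case: (cid e) => l' /= /(coord_inj coord_x) /Zp_hom_eq -> //.
have root T (l : hom T) : pev (x (l 1)) W = 0.
  by apply/(torsionP coord_x ab mulpW)/Zp_hom_torsion.
have root_hom T (y : T) : pev y W = 0 -> exists l : hom T, x (l 1) = y.
  move=> Wy; have ny : nilpotent_elt y := distinguished_root dW Wy.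
  have [|l l1] := @Zp_hom_exists p (G T) p_gt1 (of_coord y).
    by apply/(torsionP coord_x ab mulpW); rewrite of_coordK.
  by exists l; rewrite l1 of_coordK.
have phi_nat T T' (u : thom T T') (y : T) :
    pev y W = 0 -> phi T' (u y) = u (phi T y).
  move=> /root_hom[l <-]; rewrite phiE -f_nat -phiE; congr (phi T' _).
  by rewrite /= (coord_nat coord_x).
have [r rE] := expansion_global complete_R G dW
  (@graded_wbasis R m.+1 V m.+2 dV) phi_nat.
have {}rE T (y : T) : pev y W = 0 ->
    phi T y = \sum_(j < m.+1) tstr T (r (widen_ord (leqnSn _) j)) * pev y 'X^j
      + tstr T (r ord_max) * pev y V.
  move=> Wy; rewrite rE // big_ord_recr /=; congr (_ + _ * _).
    by apply: eq_bigr => j _; rewrite wbasis_low // /pev evXn.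
  by have := wbasis_high m.+1 V 0 y; rewrite addn0 expr0 mul1r.
(* On {V = 0} the last term drops out and [f] vanishes by [root_level]; 1, ..., X^m are independent
   there. *)
have r_low j : r (widen_ord (leqnSn _) j) = 0.
  move: j; apply: (expansion_eq0 complete_R dV (@graded_Xn R m.+1)) => T y Vy.
  have Wy : pev y W = 0 by rewrite WE Vy mulr0.
  have := rE T y Wy; rewrite Vy mulr0 addr0 => <-.
  have [l ly] := root_hom T y Wy; rewrite -ly phiE; apply: f_level.
  by apply: root_level; rewrite ly.
(* The zero homomorphism is the root y = 0, where the remaining term is r V(0); multiplying by b(0)
   gives r p = 0. *)
have r_max : r ord_max = 0.
  have rV0 : r ord_max * V`_0 = 0.
    apply: (tstr_eq0 complete_R) => T.
    have W0 : pev (0 : T) W = 0 by rewrite WE mul0r.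
    have := phiE T (zero_hom G 'Z_p T).
    rewrite f_zero /= (Defs.coord0 coord_x) rE //.
    rewrite big1 ?add0r => [|j _]; last by rewrite r_low rmorph0 mul0r.
    rewrite rmorphM /= => <-; congr (_ * _).
    rewrite /pev (@ev_widen _ _ _ _ (size V).+1) // big_ord_recl mulr1.
    rewrite big1 ?addr0 // => i _.
    by rewrite exprS mul0r mulr0.
  apply: p_regular; rewrite mulr0 -Vb mulrC mulrA rV0 mul0r //.
move=> T l; rewrite -phiE rE // r_max rmorph0 mul0r addr0 big1 // => j _.
by rewrite r_low rmorph0 mul0r.
Qed.

End Main.

Theorem proposition9p24 (R : comUnitRingType) (k : fieldType)
    (res : {rmorphism R -> k}) (p : nat)
    (complete_R : complete_local_ring R) (res_k : residue_field res)
    (perfect_k : perfect_field p k) (p_regular : GRing.lreg (p%:R : R))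
    (G : formal_group R) (height_G : finite_height G p) :
  injective (natural_map G 'Z_p).
Proof.
have [charp _] := perfect_k; have p_prime := pcharf_prime charp.
have [_ max_res] := res_k; have [h [x [coord_x _ nfrob]]] := height_G.
have mp : maxideal (p%:R : R).
  by apply/max_res; rewrite rmorph_nat (pcharf0 charp).
have p_units j : (0 < j < p)%N -> (j%:R : R) \is a GRing.unit.
  move=> /andP[j_gt0 lt_jp]; apply/negPn/negP => /max_res/eqP.
  by rewrite rmorph_nat -(dvdn_pcharf charp) gtnNdvd.
have [m [V [a [b [dV ab Vb mulpE]]]]] :=
  weierstrass_multiplication complete_R coord_x mp nfrob.
move=> f f' [zero_ff' level_ff']; apply: ofun_ext => T l.
apply/eqP; rewrite -subr_eq0; apply/eqP.
apply: (hom_function_eq0 complete_R coord_x p_prime p_regular p_units dV ab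
  Vb mulpE (f := fun T l => f T l I - f' T l I)).
- move=> T1 T2 u l1; rewrite rmorphB.
  by rewrite -(@oev_nat _ _ _ f _ _ u _ I I) -(@oev_nat _ _ _ f' _ _ u _ I I).
- move=> T1; rewrite (zero_valueP f complete_R) (zero_valueP f' complete_R).
  by rewrite zero_ff' subrr.
move=> T1 l1 lev.
by have /= -> := congr1 (fun o => o T1 l1 lev) level_ff'; rewrite subrr.
Qed.
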